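(* Let $\Omega$ be a bounded domain in $\mathbb{C}$, let $K$ be a nonempty removable set in $\Omega$, and let $D=\Omega\setminus K$. Then for every $z\in D$, $$S_{D}(z)\le\min_{w\in K}\tanh\left[c_{\Omega}(z,w)\right].$$
   Context: Let $\mathbb{D}=\{\xi\in\mathbb{C}:|\xi|<1\}$. A compact set $K\subset\mathbb{C}$ is called removable (for bounded holomorphic functions) if for every open set $U\supseteq K$ in $\mathbb{C}$, each bounded holomorphic function on $U\setminus K$ extends holomorphically to all of $U$. A removable set in a domain $G$ is a removable compact set contained in $G$. The Carathéodory pseudodistance on a domain $G\subseteq\mathbb{C}$ is $$c_G(\xi_1,\xi_2)=\sup\{\tanh^{-1}|\alpha| : f:G\to\mathbb{D}\text{ holomorphic},\ f(\xi_1)=0,\ f(\xi_2)=\alpha\}.$$ For a bounded domain $G\subseteq\mathbb{C}$, $z\in G$, and an injective holomorphic map $f:G\to\mathbb{D}$ with $f(z)=0$, let $$S_G(z,f)=\sup\{r : \mathbb{D}(0,r)\subseteq f(G)\},$$ where $\mathbb{D}(0,r)$ is the Euclidean disc of radius $r$ centred at the origin. The squeezing function of $G$ is $S_G(z)=\sup_f S_G(z,f)$, the supremum over all injective holomorphic $f:G\to\mathbb{D}$ with $f(z)=0$. *)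

(* Defs.v *)
From Stdlib Require Import Reals List.
From Coquelicot Require Import Coquelicot.

Open Scope R_scope.

(* The set [{z | |z| < r}]; it is empty when [r <= 0]. *)
Definition disc0 (r : R) (z : C) : Prop := Cmod z < r.

Definition setminus (A B : C -> Prop) (z : C) : Prop := A z /\ ~ B z.

Definition subset (A B : C -> Prop) : Prop := forall z, A z -> B z.

(* Connectedness in the subspace topology, in terms of open sets of [C]. *)
Definition connected_set (G : C -> Prop) : Prop :=
  forall A B : C -> Prop, open A -> open B ->
    (forall z, G z -> A z \/ B z) ->
    (exists z, G z /\ A z) -> (exists z, G z /\ B z) ->
    exists z, G z /\ A z /\ B z.

Definition is_domain (G : C -> Prop) : Prop :=
  (exists z, G z) /\ open G /\ connected_set G.

Definition bounded_set (G : C -> Prop) : Prop :=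
  exists M : R, forall z, G z -> Cmod z <= M.

Definition compact_set (K : C -> Prop) : Prop :=
  forall (I : Type) (V : I -> C -> Prop),
    (forall i, open (V i)) ->
    (forall z, K z -> exists i, V i z) ->
    exists l : list I, forall z, K z -> exists i, In i l /\ V i z.

(* Functions on a subset of [C] are represented by total functions whose values
   off the subset are irrelevant.  As [ex_derive f z] only depends on [f] near
   [z], this is faithful on open [G], the only sets it is meant for.  The
   derivative is the complex one (scalar field [C_AbsRing]). *)
Definition holomorphic_on (G : C -> Prop) (f : C -> C) : Prop :=
  forall z, G z -> ex_derive (K := C_AbsRing) (V := C_NormedModule) f z.

Definition bounded_on (G : C -> Prop) (f : C -> C) : Prop :=
  exists M : R, forall z, G z -> Cmod (f z) <= M.

Definition injective_on (G : C -> Prop) (f : C -> C) : Prop :=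
  forall x y, G x -> G y -> f x = f y -> x = y.

Definition removable (K : C -> Prop) : Prop :=
  compact_set K /\
  forall U : C -> Prop, open U -> subset K U ->
    forall f : C -> C,
      holomorphic_on (setminus U K) f -> bounded_on (setminus U K) f ->
      exists g : C -> C,
        holomorphic_on U g /\ forall z, setminus U K z -> g z = f z.

Definition removable_in (G K : C -> Prop) : Prop :=
  removable K /\ subset K G.

Definition hol_to_disc (G : C -> Prop) (f : C -> C) : Prop :=
  holomorphic_on G f /\ forall z, G z -> disc0 1 (f z).

(* Supremum in [R]; it is the least upper bound of [E] when [E] is nonempty and
   bounded above (and 0 otherwise). *)
Definition Rsup (E : R -> Prop) : R := real (Lub_Rbar E).

(* Inverse of [tanh] on [(-1, 1)]. *)
Definition artanh (x : R) : R := ln ((1 + x) / (1 - x)) / 2.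

(* The supremum is over a nonempty set (take [f = 0]), which is bounded above
   when [G] is a domain containing [z1] and [z2] (Schwarz-Pick along a chain of
   discs joining the two points). *)
Definition caratheodory (G : C -> Prop) (z1 z2 : C) : R :=
  Rsup (fun a => exists f : C -> C,
          hol_to_disc G f /\ f z1 = RtoC 0 /\ a = artanh (Cmod (f z2))).

(* Nonpositive [r] always qualify in the set below; they do not affect the
   supremum, which is nonnegative anyway since [r = 0] qualifies. *)
Definition squeezing_map (G : C -> Prop) (f : C -> C) : R :=
  Rsup (fun r => forall y, disc0 r y -> exists x, G x /\ f x = y).

Definition squeezing (G : C -> Prop) (z : C) : R :=
  Rsup (fun s => exists f : C -> C,
          hol_to_disc G f /\ injective_on G f /\ f z = RtoC 0 /\
          s = squeezing_map G f).

(* Main.v *)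
Require Import Defs.
From Stdlib Require Import Reals Lra Psatz List Classical.
From Coquelicot Require Import Coquelicot.

Open Scope R_scope.

(* An injective holomorphic f : Omega \ K -> D with f(z) = 0 extends to
   F : Omega -> C with |F| <= 1.  Since the complement of K is dense, the open
   mapping property of f shows that F(w), for w in K, is not a value of f:
   otherwise f would take some value near F(w) twice.  Hence a disc
   D(0, r) contained in the image of f has r <= |F(w)| <= tanh c_Omega(z, w).
   The minimum over K exists because c_Omega(z, .) is a pointwise supremum of
   continuous functions, hence lower semicontinuous.  The complex analysis
   behind this all follows from the maximum principle at the center of a disc,
   which Goursat's lemma yields in logarithmic polar coordinates. *)

(** * Complex differentiability *)

(** All facts on holomorphic functions are drawn from one real identity: the imaginary part of a
    rectangle integral vanishes. On vertical sides dz = i dt, so that this part sees Re g; and exp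
    maps a rectangle of height 2 PI onto an annulus, so no integrals along curves occur. Every later
    estimate is arranged as a comparison between a circle and its centre.

    [Rsup] returns 0 on a set unbounded above, so [caratheodory] dominates its competitors only once
    these are known to be bounded. This is why a Schwarz-Pick estimate is required: the values at
    [w] of the maps vanishing at [z] must stay uniformly away from the unit circle. A crude constant
    is enough, provided that it depends on the previous bound alone and so propagates through a
    connected domain. *)

Definition ccont (f : C -> C) (x : C) : Prop :=
  forall eps, 0 < eps -> exists d, 0 < d /\
    forall y, Cmod (y - x) < d -> Cmod (f y - f x) < eps.

Definition cdiff (f : C -> C) (x : C) : Prop :=
  ex_derive (K := C_AbsRing) (V := C_NormedModule) f x.

(** The balls of the uniform structure of an absolute ring are [Cmod] discs by conversion, so the
    general rules for continuity transfer. *)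
Lemma ccont_continuous (f : C -> C) (x : C) :
  ccont f x <->
  @continuous (AbsRing_UniformSpace C_AbsRing) (AbsRing_UniformSpace C_AbsRing)
    f x.
Proof.
  split.
  - intros H. apply filterlim_locally. intros eps.
    destruct (H eps (cond_pos eps)) as (d & Hd & Hy).
    exists (mkposreal d Hd). exact Hy.
  - intros H eps He.
    destruct (proj1 (filterlim_locally (U := AbsRing_UniformSpace C_AbsRing) _ _)
                H (mkposreal eps He)) as (d & Hd).
    exists d. split; [apply cond_pos | exact Hd].
Qed.

Lemma ccont_const (c x : C) : ccont (fun _ => c) x.
Proof.
  intros eps He. exists 1. split; [lra|]. intros y _.
  replace (c - c)%C with (RtoC 0) by ring. now rewrite Cmod_0.
Qed.

Lemma ccont_id (x : C) : ccont (fun y => y) x.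
Proof. intros eps He. exists eps. split; [exact He | auto]. Qed.

Lemma ccont_plus (f g : C -> C) (x : C) :
  ccont f x -> ccont g x -> ccont (fun y => f y + g y)%C x.
Proof.
  intros Hf%ccont_continuous Hg%ccont_continuous. apply ccont_continuous.
  exact (continuous_plus (U := AbsRing_UniformSpace C_AbsRing)
           (V := AbsRing_NormedModule C_AbsRing) f g x Hf Hg).
Qed.

Lemma ccont_mult (f g : C -> C) (x : C) :
  ccont f x -> ccont g x -> ccont (fun y => f y * g y)%C x.
Proof.
  intros Hf%ccont_continuous Hg%ccont_continuous. apply ccont_continuous.
  exact (continuous_mult (U := AbsRing_UniformSpace C_AbsRing)
           (K := C_AbsRing) f g x Hf Hg).
Qed.

Lemma ccont_comp (f g : C -> C) (x : C) :
  ccont f x -> ccont g (f x) -> ccont (fun y => g (f y)) x.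
Proof.
  intros Hf%ccont_continuous Hg%ccont_continuous. apply ccont_continuous.
  exact (continuous_comp _ _ _ Hf Hg).
Qed.

Lemma Cmod_minus_sym (x y : C) : Cmod (x - y) = Cmod (y - x).
Proof. rewrite <- Cmod_opp. f_equal. ring. Qed.

Lemma Cmod_minus_ge (x y : C) : Cmod x - Cmod y <= Cmod (x - y).
Proof.
  pose proof (Cmod_triangle (x - y) y) as H.
  replace (x - y + y)%C with x in H by ring. lra.
Qed.

Lemma Cminus_eq_0 (x y : C) : (x - y = 0)%C -> x = y.
Proof. intros H. replace x with ((x - y) + y)%C by ring. rewrite H. ring. Qed.

Lemma ccont_inv (f : C -> C) (x : C) :
  ccont f x -> f x <> RtoC 0 -> ccont (fun y => / f y)%C x.
Proof.
  intros Hf H0 eps He.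
  assert (Hm : 0 < Cmod (f x)) by now apply Cmod_gt_0.
  set (m := Cmod (f x)) in *.
  (* The first bound keeps |f y| above m / 2; the second then makes |f x - f y| / (|f y| m) less
     than [eps]. *)
  assert (Hpos : 0 < Rmin (m / 2) (eps * (m * m / 2))).
  { apply Rmin_pos; [lra|]. apply Rmult_lt_0_compat; [lra|]. nra. }
  destruct (Hf _ Hpos) as (d & Hd & Hy).
  exists d. split; [exact Hd|]. intros y Hyd. specialize (Hy y Hyd).
  pose proof (Rmin_l (m / 2) (eps * (m * m / 2))).
  pose proof (Rmin_r (m / 2) (eps * (m * m / 2))).
  pose proof (Cmod_minus_ge (f x) (f y)) as Ht.
  rewrite Cmod_minus_sym in Ht. fold m in Ht.
  assert (Hfy : m / 2 < Cmod (f y)) by lra.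
  assert (Hy0 : f y <> RtoC 0) by (apply Cmod_gt_0; lra).
  replace (/ f y - / f x)%C with ((f x - f y) / (f y * f x))%C
    by (field; auto).
  rewrite Cmod_div by now apply Cmult_neq_0.
  rewrite Cmod_mult, Cmod_minus_sym. fold m.
  apply Rmult_lt_reg_r with (Cmod (f y) * m); [nra|].
  unfold Rdiv. rewrite Rmult_assoc, Rinv_l by nra.
  nra.
Qed.

Lemma ccont_minus (f g : C -> C) (x : C) :
  ccont f x -> ccont g x -> ccont (fun y => f y - g y)%C x.
Proof.
  intros Hf%ccont_continuous Hg%ccont_continuous. apply ccont_continuous.
  exact (continuous_minus (U := AbsRing_UniformSpace C_AbsRing)
           (V := AbsRing_NormedModule C_AbsRing) f g x Hf Hg).
Qed.

(* Caratheodory's characterization, from which the rules of differentiation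
   become algebraic identities. *)
Lemma cdiff_slope (f : C -> C) (x : C) :
  cdiff f x <->
  exists phi : C -> C,
    ccont phi x /\ forall y, f y = (f x + phi y * (y - x))%C.
Proof.
  split.
  - intros (l & _ & Hl).
    specialize (Hl x (fun P H => H)).
    exists (fun y => if Ceq_dec y x then l else (f y - f x) / (y - x))%C.
    split.
    + intros eps He.
      assert (He2 : 0 < eps / 2) by lra.
      destruct (Hl (mkposreal _ He2)) as (d & Hd).
      exists d. split; [apply cond_pos|]. intros y Hy.
      destruct (Ceq_dec x x) as [_|n]; [|now elim n].
      destruct (Ceq_dec y x) as [->|n].
      * replace (l - l)%C with (RtoC 0) by ring. now rewrite Cmod_0.
      * specialize (Hd y Hy).
        change (Cmod ((f y - f x) - (y - x) * l) <= eps / 2 * Cmod (y - x)) in Hd.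
        assert (Hn : (y - x)%C <> RtoC 0) by (intros E; now apply n, Cminus_eq_0).
        replace ((f y - f x) / (y - x) - l)%C
          with (((f y - f x) - (y - x) * l) / (y - x))%C by now field.
        rewrite Cmod_div by exact Hn.
        apply Cmod_gt_0 in Hn.
        apply Rmult_lt_reg_r with (Cmod (y - x)); [exact Hn|].
        unfold Rdiv. rewrite Rmult_assoc, Rinv_l by lra. nra.
    + intros y. destruct (Ceq_dec y x) as [->|n]; [ring|].
      field. intros E; now apply n, Cminus_eq_0.
  - intros (phi & Hc & Hphi). exists (phi x). split.
    + apply (is_linear_scal_l (K := C_AbsRing) (V := C_NormedModule)).
    + intros z Hz eps.
      apply (is_filter_lim_locally_unique (K := C_AbsRing)
              (V := AbsRing_NormedModule C_AbsRing)) in Hz.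
      subst z.
      destruct (Hc eps (cond_pos eps)) as (d & Hd & Hy).
      exists (mkposreal d Hd). intros y Hyd. specialize (Hy y Hyd).
      change (Cmod ((f y - f x) - (y - x) * phi x) <= eps * Cmod (y - x)).
      rewrite (Hphi y).
      replace (f x + phi y * (y - x) - f x - (y - x) * phi x)%C
        with ((phi y - phi x) * (y - x))%C by ring.
      rewrite Cmod_mult. apply Rmult_le_compat_r; [apply Cmod_ge_0 | lra].
Qed.

Lemma cdiff_ccont (f : C -> C) (x : C) : cdiff f x -> ccont f x.
Proof.
  intros (phi & Hc & Hphi)%cdiff_slope.
  intros eps He.
  destruct (ccont_mult phi (fun y => y - x)%C x Hc
    (ccont_minus _ _ x (ccont_id x) (ccont_const x x)) eps He) as (d & Hd & Hy).
  exists d. split; [exact Hd|]. intros y Hyd. specialize (Hy y Hyd).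
  rewrite Hphi.
  replace (f x + phi y * (y - x) - f x)%C
    with (phi y * (y - x) - phi x * (x - x))%C by ring.
  exact Hy.
Qed.

Lemma cdiff_const (c x : C) : cdiff (fun _ => c) x.
Proof.
  apply cdiff_slope. exists (fun _ => RtoC 0). split; [apply ccont_const|].
  intros y. ring.
Qed.

Lemma cdiff_id (x : C) : cdiff (fun y => y) x.
Proof.
  apply cdiff_slope. exists (fun _ => 1%C). split; [apply ccont_const|].
  intros y. ring.
Qed.

Lemma cdiff_plus (f g : C -> C) (x : C) :
  cdiff f x -> cdiff g x -> cdiff (fun y => f y + g y)%C x.
Proof.
  intros (p & Hp & Ep)%cdiff_slope (q & Hq & Eq)%cdiff_slope.
  apply cdiff_slope. exists (fun y => p y + q y)%C.
  split; [now apply ccont_plus|]. intros y. rewrite Ep, Eq. ring.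
Qed.

Lemma cdiff_mult (f g : C -> C) (x : C) :
  cdiff f x -> cdiff g x -> cdiff (fun y => f y * g y)%C x.
Proof.
  intros Hf Hg. pose proof (cdiff_ccont _ _ Hf) as Hfc.
  destruct (proj1 (cdiff_slope f x) Hf) as (p & Hp & Ep).
  destruct (proj1 (cdiff_slope g x) Hg) as (q & Hq & Eq).
  apply cdiff_slope. exists (fun y => p y * g x + f y * q y)%C. split.
  - apply ccont_plus; apply ccont_mult; auto using ccont_const.
  - intros y. rewrite (Eq y), (Ep y). ring.
Qed.

Lemma cdiff_minus (f g : C -> C) (x : C) :
  cdiff f x -> cdiff g x -> cdiff (fun y => f y - g y)%C x.
Proof.
  intros (p & Hp & Ep)%cdiff_slope (q & Hq & Eq)%cdiff_slope.
  apply cdiff_slope. exists (fun y => p y - q y)%C.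
  split; [now apply ccont_minus|]. intros y. rewrite Ep, Eq. ring.
Qed.

Lemma cdiff_comp (f g : C -> C) (x : C) :
  cdiff f x -> cdiff g (f x) -> cdiff (fun y => g (f y)) x.
Proof.
  intros Hf Hg. pose proof (cdiff_ccont _ _ Hf) as Hfc.
  destruct (proj1 (cdiff_slope f x) Hf) as (p & Hp & Ep).
  destruct (proj1 (cdiff_slope g (f x)) Hg) as (q & Hq & Eq).
  apply cdiff_slope. exists (fun y => q (f y) * p y)%C. split.
  - apply ccont_mult; [|exact Hp]. now apply ccont_comp with (g := q).
  - intros y. rewrite (Eq (f y)), (Ep y). ring.
Qed.

Lemma cdiff_Cinv (a : C) : a <> RtoC 0 -> cdiff Cinv a.
Proof.
  intros Ha. apply cdiff_slope.
  (* As [/ 0 = 0], the slope identity at [w = 0] reads 0 = 1/a + phi(0) (0 - a), which forces this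
     separate value. *)
  exists (fun w => if Ceq_dec w 0 then / (a * a) else - / (w * a))%C. split.
  - assert (Hc : ccont (fun w => - / (w * a))%C a).
    { apply ccont_comp with (g := Copp) (f := fun w => (/ (w * a))%C).
      - apply ccont_inv; [|now apply Cmult_neq_0].
        apply ccont_mult; [apply ccont_id | apply ccont_const].
      - intros eps He. exists eps. split; [exact He|]. intros y Hy.
        replace (- y - - / (a * a))%C with (- (y - / (a * a)))%C by ring.
        now rewrite Cmod_opp. }
    intros eps He. destruct (Hc eps He) as (d & Hd & Hy).
    apply Cmod_gt_0 in Ha.
    exists (Rmin d (Cmod a)). split; [now apply Rmin_pos|].
    intros y Hyd.
    pose proof (Rmin_l d (Cmod a)). pose proof (Rmin_r d (Cmod a)).
    destruct (Ceq_dec y 0) as [->|_].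
    { replace (0 - a)%C with (- a)%C in Hyd by ring.
      rewrite Cmod_opp in Hyd. lra. }
    destruct (Ceq_dec a 0) as [->|_]; [rewrite Cmod_0 in Ha; lra|].
    apply Hy. lra.
  - intros y. destruct (Ceq_dec y 0) as [->|Hy]; [|field; auto].
    replace (/ RtoC 0)%C with (RtoC 0); [field; auto|].
    unfold Cinv. simpl. apply injective_projections; simpl; unfold Rdiv; ring.
Qed.

Lemma cdiff_inv (f : C -> C) (x : C) :
  f x <> RtoC 0 -> cdiff f x -> cdiff (fun y => / f y)%C x.
Proof. intros H0 Hf. apply cdiff_comp; [exact Hf | now apply cdiff_Cinv]. Qed.

(** * Goursat's lemma for rectangles *)

Lemma fst_le_Cmod (z : C) : Rabs (fst z) <= Cmod z.
Proof. eapply Rle_trans; [apply Rmax_l | apply Rmax_Cmod]. Qed.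

Lemma snd_le_Cmod (z : C) : Rabs (snd z) <= Cmod z.
Proof. eapply Rle_trans; [apply Rmax_r | apply Rmax_Cmod]. Qed.

Lemma Cmod_le_abs (z : C) : Cmod z <= Rabs (fst z) + Rabs (snd z).
Proof.
  pose proof (Rabs_pos (fst z)). pose proof (Rabs_pos (snd z)).
  unfold Cmod. apply Rsqr_incr_0; [|apply sqrt_pos|lra].
  rewrite Rsqr_sqrt by nra. unfold Rsqr.
  rewrite <- (pow2_abs (fst z)), <- (pow2_abs (snd z)). nra.
Qed.

Lemma Cmod_hor (x y t : R) : Cmod ((x, t) - (y, t))%C = Rabs (x - y).
Proof.
  rewrite <- Cmod_R. f_equal. apply injective_projections; simpl; ring.
Qed.

Lemma Cmod_ver (x y t : R) : Cmod ((t, x) - (t, y))%C = Rabs (x - y).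
Proof.
  replace ((t, x) - (t, y))%C with (Ci * (x - y)%R)%C
    by (apply injective_projections; simpl; ring).
  now rewrite Cmod_mult, Cmod_Ci, Cmod_R, Rmult_1_l.
Qed.

Lemma ccont_path (g : C -> C) (p : R -> C) (s : R) :
  (forall t, Cmod (p t - p s) <= Rabs (t - s)) -> ccont g (p s) ->
  continuous (fun t => fst (g (p t))) s /\ continuous (fun t => snd (g (p t))) s.
Proof.
  intros Hp Hg. split; apply filterlim_locally; intros eps;
  destruct (Hg eps (cond_pos eps)) as (d & Hd & Hy);
  exists (mkposreal d Hd); intros t Ht;
  specialize (Hy (p t) (Rle_lt_trans _ _ _ (Hp t) Ht)).
  - eapply Rle_lt_trans; [apply (fst_le_Cmod (g (p t) - g (p s))) | exact Hy].
  - eapply Rle_lt_trans; [apply (snd_le_Cmod (g (p t) - g (p s))) | exact Hy].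
Qed.

Lemma continuous_fst_ver (g : C -> C) (x t : R) :
  ccont g (x, t) -> continuous (fun t => fst (g (x, t))) t.
Proof.
  intros H. apply (ccont_path g (fun t => (x, t)) t); [|exact H].
  intros u. now rewrite Cmod_ver; apply Rle_refl.
Qed.

Lemma continuous_snd_hor (g : C -> C) (s y : R) :
  ccont g (s, y) -> continuous (fun s => snd (g (s, y))) s.
Proof.
  intros H. apply (ccont_path g (fun s => (s, y)) s); [|exact H].
  intros u. now rewrite Cmod_hor; apply Rle_refl.
Qed.

Definition on_rect (P : C -> Prop) (x y h k : R) : Prop :=
  forall s t, x <= s <= x + h -> y <= t <= y + k -> P (s, t).

(* The imaginary part of the integral of [g] along the boundary of the
   rectangle [x, x + h] * [y, y + k]. *)
Definition rect_int (g : C -> C) (x y h k : R) : R :=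
  RInt (fun t => fst (g (x + h, t)) - fst (g (x, t))) y (y + k) -
  RInt (fun s => snd (g (s, y + k)) - snd (g (s, y))) x (x + h).

Lemma ex_RInt_ver (g : C -> C) (x y h k s : R) :
  0 <= k -> on_rect (ccont g) x y h k -> x <= s <= x + h ->
  ex_RInt (fun t => fst (g (s, t))) y (y + k).
Proof.
  intros Hk Hg Hs. apply (ex_RInt_continuous (V := R_CompleteNormedModule)).
  rewrite Rmin_left, Rmax_right by lra.
  intros t Ht. now apply continuous_fst_ver, Hg.
Qed.

Lemma ex_RInt_hor (g : C -> C) (x y h k t : R) :
  0 <= h -> on_rect (ccont g) x y h k -> y <= t <= y + k ->
  ex_RInt (fun s => snd (g (s, t))) x (x + h).
Proof.
  intros Hh Hg Ht. apply (ex_RInt_continuous (V := R_CompleteNormedModule)).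
  rewrite Rmin_left, Rmax_right by lra.
  intros s Hs. now apply continuous_snd_hor, Hg.
Qed.

Lemma RInt_Rminus (f g : R -> R) (a b : R) :
  ex_RInt f a b -> ex_RInt g a b ->
  RInt (fun t => f t - g t) a b = RInt f a b - RInt g a b.
Proof. exact (RInt_minus (V := R_CompleteNormedModule) f g a b). Qed.

Lemma rect_int_boundary (g : C -> C) (x y h k : R) :
  0 <= h -> 0 <= k -> on_rect (ccont g) x y h k ->
  rect_int g x y h k =
  RInt (fun t => fst (g (x + h, t))) y (y + k)
  - RInt (fun t => fst (g (x, t))) y (y + k)
  - (RInt (fun s => snd (g (s, y + k))) x (x + h)
     - RInt (fun s => snd (g (s, y))) x (x + h)).
Proof.
  intros Hh Hk Hg. unfold rect_int.
  rewrite !RInt_Rminus; [reflexivity| | | |].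
  1,2: apply ex_RInt_hor with (h := h) (y := y) (k := k); auto; lra.
  all: apply ex_RInt_ver with (x := x) (h := h); auto; lra.
Qed.

(** The common vertical side cancels, and Chasles' relation joins the horizontal ones. *)
Lemma rect_int_split_h (g : C -> C) (x y h h' k : R) :
  0 <= h -> 0 <= h' -> 0 <= k -> on_rect (ccont g) x y (h + h') k ->
  rect_int g x y (h + h') k = rect_int g x y h k + rect_int g (x + h) y h' k.
Proof.
  intros Hh Hh' Hk Hg.
  assert (H1 : on_rect (ccont g) x y h k) by (intros s t ? ?; apply Hg; lra).
  assert (H2 : on_rect (ccont g) (x + h) y h' k)
    by (intros s t ? ?; apply Hg; lra).
  rewrite !rect_int_boundary by (auto; lra).
  replace (x + (h + h')) with (x + h + h') by ring.
  rewrite <- (RInt_Chasles (V := R_CompleteNormedModule)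
               (fun s => snd (g (s, y + k))) x (x + h) (x + h + h')).
  rewrite <- (RInt_Chasles (V := R_CompleteNormedModule)
               (fun s => snd (g (s, y))) x (x + h) (x + h + h')).
  { unfold plus; simpl. lra. }
  all: eapply ex_RInt_hor; eauto; lra.
Qed.

Lemma rect_int_split_k (g : C -> C) (x y h k k' : R) :
  0 <= h -> 0 <= k -> 0 <= k' -> on_rect (ccont g) x y h (k + k') ->
  rect_int g x y h (k + k') = rect_int g x y h k + rect_int g x (y + k) h k'.
Proof.
  intros Hh Hk Hk' Hg.
  assert (H1 : on_rect (ccont g) x y h k) by (intros s t ? ?; apply Hg; lra).
  assert (H2 : on_rect (ccont g) x (y + k) h k')
    by (intros s t ? ?; apply Hg; lra).
  rewrite !rect_int_boundary by (auto; lra).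
  replace (y + (k + k')) with (y + k + k') by ring.
  rewrite <- (RInt_Chasles (V := R_CompleteNormedModule)
               (fun t => fst (g (x + h, t))) y (y + k) (y + k + k')).
  rewrite <- (RInt_Chasles (V := R_CompleteNormedModule)
               (fun t => fst (g (x, t))) y (y + k) (y + k + k')).
  { unfold plus; simpl. lra. }
  all: eapply ex_RInt_ver; eauto; lra.
Qed.

Lemma RInt_near_const (f : R -> R) (a k A B : R) :
  0 <= k -> ex_RInt f a (a + k) ->
  (forall t, a <= t <= a + k -> Rabs (f t - A) <= B) ->
  Rabs (RInt f a (a + k) - k * A) <= k * B.
Proof.
  intros Hk Hf HB.
  replace (k * A) with (RInt (fun _ => A) a (a + k)).
  2:{ rewrite RInt_const. unfold scal; simpl; unfold mult; simpl. ring. }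
  rewrite <- RInt_Rminus; [|exact Hf|apply ex_RInt_const].
  replace (k * B) with ((a + k - a) * B) by ring.
  apply abs_RInt_le_const; [lra| |exact HB].
  apply (ex_RInt_minus (V := R_CompleteNormedModule) f (fun _ => A));
    [exact Hf | apply ex_RInt_const].
Qed.

(* The Cauchy-Riemann equations: for affine [g] the integral vanishes, and the
   remainder of the first-order expansion at a point of the rectangle is small
   compared to the perimeter squared. *)
Lemma rect_int_small (g : C -> C) (u v eps : R) :
  0 < eps -> cdiff g (u, v) ->
  exists d, 0 < d /\ forall x y h k, 0 <= h -> 0 <= k -> h + k < d ->
    x <= u <= x + h -> y <= v <= y + k -> on_rect (ccont g) x y h k ->
    Rabs (rect_int g x y h k) <= eps * (h + k)².
Proof.
  intros He Hg. apply cdiff_slope in Hg. destruct Hg as (phi & Hc & Hphi).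
  (* The error on each side is at most [eps / 2 * (h + k)], hence [eps * (h + k)] for two opposite
     sides; integration over lengths [k] and [h] yields [eps * (h + k)²]. *)
  assert (He2 : 0 < eps / 2) by lra.
  destruct (Hc _ He2) as (d & Hd & Hy).
  exists d. split; [exact Hd|].
  intros x y h k Hh Hk Hhk Hu Hv Hcont.
  set (l := phi (u, v)) in *.
  set (e := fun z => ((phi z - l) * (z - (u, v)))%C).
  assert (Hexp : forall s t,
    g (s, t) = (g (u, v) + l * ((s, t) - (u, v)) + e (s, t))%C).
  { intros s t. rewrite (Hphi (s, t)). unfold e. ring. }
  assert (Hsmall : forall s t, x <= s <= x + h -> y <= t <= y + k ->
            Cmod (e (s, t)) <= eps / 2 * (h + k)).
  { intros s t Hs Ht. unfold e. rewrite Cmod_mult.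
    assert (Hst : Cmod ((s, t) - (u, v)) <= h + k).
    { eapply Rle_trans; [apply Cmod_le_abs|]. simpl.
      apply Rplus_le_compat; apply Rabs_le; lra. }
    apply Rmult_le_compat; try apply Cmod_ge_0; [|exact Hst].
    left. apply Hy. lra. }
  assert (Hver : forall t, y <= t <= y + k ->
    Rabs (fst (g (x + h, t)) - fst (g (x, t)) - h * fst l) <= eps * (h + k)).
  { intros t Ht. rewrite (Hexp (x + h) t), (Hexp x t). simpl fst.
    pose proof (Hsmall (x + h) t ltac:(lra) Ht) as H1.
    pose proof (Hsmall x t ltac:(lra) Ht) as H2.
    pose proof (fst_le_Cmod (e (x + h, t))) as H3.
    pose proof (fst_le_Cmod (e (x, t))) as H4.
    apply Rle_trans with (Rabs (fst (e (x + h, t)) - fst (e (x, t)))).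
    - right. f_equal. simpl. ring.
    - unfold Rminus at 1. eapply Rle_trans; [apply Rabs_triang|].
      rewrite Rabs_Ropp. lra. }
  assert (Hhor : forall s, x <= s <= x + h ->
    Rabs (snd (g (s, y + k)) - snd (g (s, y)) - k * fst l) <= eps * (h + k)).
  { intros s Hs. rewrite (Hexp s (y + k)), (Hexp s y). simpl snd.
    pose proof (Hsmall s (y + k) Hs ltac:(lra)) as H1.
    pose proof (Hsmall s y Hs ltac:(lra)) as H2.
    pose proof (snd_le_Cmod (e (s, y + k))) as H3.
    pose proof (snd_le_Cmod (e (s, y))) as H4.
    apply Rle_trans with (Rabs (snd (e (s, y + k)) - snd (e (s, y)))).
    - right. f_equal. simpl. ring.
    - unfold Rminus at 1. eapply Rle_trans; [apply Rabs_triang|].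
      rewrite Rabs_Ropp. lra. }
  apply RInt_near_const in Hver; [|exact Hk|].
  2:{ apply (ex_RInt_minus (V := R_CompleteNormedModule));
      eapply ex_RInt_ver; eauto; lra. }
  apply RInt_near_const in Hhor; [|exact Hh|].
  2:{ apply (ex_RInt_minus (V := R_CompleteNormedModule));
      eapply ex_RInt_hor; eauto; lra. }
  unfold rect_int.
  (* Both pairs of sides have the main term [h * k * fst l], which cancels. *)
  match goal with |- Rabs (?a - ?b) <= _ =>
    replace (a - b) with ((a - k * (h * fst l)) - (b - h * (k * fst l))) by ring
  end.
  unfold Rminus at 1. eapply Rle_trans; [apply Rabs_triang|].
  rewrite Rabs_Ropp. unfold Rsqr. nra.
Qed.

(** The hypothesis makes the left ends increase and the right ends [x n + h / 2 ^ n] decrease, so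
    the supremum of the left ends lies in all intervals. *)
Lemma nested_intervals (x : nat -> R) (h : R) :
  0 <= h ->
  (forall n, x n <= x (S n) <= x n + h / 2 ^ S n) ->
  exists u, forall n, x n <= u <= x n + h / 2 ^ n.
Proof.
  intros Hh Hx.
  assert (H2 : forall n, 0 < 2 ^ n) by (intros n; apply pow_lt; lra).
  assert (Hdec : forall n, x (S n) + h / 2 ^ S n <= x n + h / 2 ^ n).
  { intros n. specialize (Hx n). specialize (H2 n).
    replace (h / 2 ^ n) with (h / 2 ^ S n + h / 2 ^ S n)
      by (simpl; field; lra). lra. }
  assert (Hle : forall n m, x n <= x (n + m)%nat /\
             x (n + m)%nat + h / 2 ^ (n + m) <= x n + h / 2 ^ n).
  { intros n m. induction m as [|m IH].
    - rewrite Nat.add_0_r. lra.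
    - rewrite Nat.add_succ_r. specialize (Hx (n + m)%nat).
      specialize (Hdec (n + m)%nat). lra. }
  assert (Hbd : forall n m, x n <= x m + h / 2 ^ m).
  { intros n m.
    assert (Hp : forall j, 0 <= h / 2 ^ j)
      by (intros j; apply Rdiv_le_0_compat; auto).
    destruct (Nat.le_ge_cases n m) as [L|L].
    - replace m with (n + (m - n))%nat by (now rewrite Nat.add_comm, Nat.sub_add).
      pose proof (Hle n (m - n)%nat). pose proof (Hp (n + (m - n))%nat). lra.
    - replace n with (m + (n - m))%nat by (now rewrite Nat.add_comm, Nat.sub_add).
      pose proof (Hle m (n - m)%nat). pose proof (Hp (m + (n - m))%nat). lra. }
  destruct (completeness (fun r => exists n, r = x n)) as (u & Hub & Hlub).
  - exists (x 0%nat + h / 2 ^ 0). intros r (n & ->). apply Hbd.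
  - now exists (x 0%nat), 0%nat.
  - exists u. intros n. split.
    + apply Hub. now exists n.
    + apply Hlub. intros r (m & ->). apply Hbd.
Qed.

(** Quartering: the ratio of the integral to (h + k)² cannot drop below [eps] on all four quarters,
    since their squares add up to that of the parent. At the common point of the nested bad
    rectangles this contradicts [rect_int_small]. *)
Lemma goursat (g : C -> C) (x0 y0 h k : R) :
  0 <= h -> 0 <= k -> on_rect (cdiff g) x0 y0 h k -> rect_int g x0 y0 h k = 0.
Proof.
  intros Hh Hk Hdiff.
  assert (Hcont : on_rect (ccont g) x0 y0 h k)
    by (intros s t ? ?; now apply cdiff_ccont, Hdiff).
  destruct (Req_dec (rect_int g x0 y0 h k) 0) as [E|Hne]; [exact E|exfalso].
  apply Rabs_pos_lt in Hne.
  set (T := Rabs (rect_int g x0 y0 h k)) in *.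
  (* The value ensures [eps * (h + k)² < T]; adding 1 keeps the denominator positive for a
     degenerate rectangle. *)
  set (eps := T / (2 * ((h + k)² + 1))).
  assert (Hsq : 0 <= (h + k)²) by apply Rle_0_sqr.
  assert (Heps : 0 < eps) by (apply Rdiv_lt_0_compat; lra).
  assert (HepsT : eps * (h + k)² < T).
  { unfold eps. apply Rmult_lt_reg_r with (2 * ((h + k)² + 1)); [lra|].
    replace (T / (2 * ((h + k)² + 1)) * (h + k)² * (2 * ((h + k)² + 1)))
      with (T * (h + k)²) by (field; lra). nra. }
  assert (H2 : forall n, 0 < 2 ^ n) by (intros n; apply pow_lt; lra).
  set (bad := fun n (p : R * R) => eps * (h / 2 ^ n + k / 2 ^ n)² <
                Rabs (rect_int g (fst p) (snd p) (h / 2 ^ n) (k / 2 ^ n))).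
  (* The last quarter is a default: it is shown to be bad by exclusion of the other three. *)
  set (step := fun n (p : R * R) =>
    let h' := h / 2 ^ S n in let k' := k / 2 ^ S n in
    let test q := Rlt_dec (eps * (h' + k')²)
      (Rabs (rect_int g (fst q) (snd q) h' k')) in
    if test p then p
    else if test (fst p + h', snd p) then (fst p + h', snd p)
    else if test (fst p, snd p + k') then (fst p, snd p + k')
    else (fst p + h', snd p + k')).
  set (c := fix c n := match n with O => (x0, y0) | S n => step n (c n) end).
  assert (Hp : forall n, 0 <= h / 2 ^ n /\ 0 <= k / 2 ^ n)
      by (intros j; split; apply Rdiv_le_0_compat; auto).
  assert (Hstep : forall n p, fst p <= fst (step n p) <= fst p + h / 2 ^ S n /\
                              snd p <= snd (step n p) <= snd p + k / 2 ^ S n).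
  { intros n p. pose proof (Hp (S n)). unfold step.
    repeat destruct Rlt_dec; cbn [fst snd]; lra. }
  assert (Hhalf : forall a n, a / 2 ^ n = a / 2 ^ S n + a / 2 ^ S n)
    by (intros a n; specialize (H2 n); simpl; field; lra).
  assert (Hin : forall n, x0 <= fst (c n) /\ fst (c n) + h / 2 ^ n <= x0 + h /\
                          y0 <= snd (c n) /\ snd (c n) + k / 2 ^ n <= y0 + k).
  { induction n as [|n IH]; [simpl; lra|].
    pose proof (Hstep n (c n)). pose proof (Hhalf h n). pose proof (Hhalf k n).
    change (c (S n)) with (step n (c n)). lra. }
  assert (Hbad : forall n, bad n (c n)).
  { induction n as [|n IH].
    - unfold bad. simpl. rewrite !Rdiv_1_r. exact HepsT.
    - change (c (S n)) with (step n (c n)). unfold bad in IH |- *.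
      pose proof (Hin n) as Hn. pose proof (Hp (S n)) as Hpn.
      set (p := c n) in *. clearbody p.
      rewrite (Hhalf h n), (Hhalf k n) in IH, Hn.
      unfold step. set (h' := h / 2 ^ S n) in *. set (k' := k / 2 ^ S n) in *.
      destruct Rlt_dec as [L1|L1]; [exact L1|].
      destruct Rlt_dec as [L2|L2]; [exact L2|].
      destruct Rlt_dec as [L3|L3]; [exact L3|].
      apply Rnot_le_lt. intros L4.
      cbn [fst snd] in *.
      apply Rnot_lt_le in L1, L2, L3. apply Rlt_not_le in IH. apply IH.
      rewrite rect_int_split_h, !rect_int_split_k; try lra.
      2,3,4: intros s t ? ?; apply Hcont; lra.
      match goal with |- Rabs (?a + ?b + (?c + ?d)) <= _ =>
        pose proof (Rabs_triang (a + b) (c + d));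
        pose proof (Rabs_triang a b); pose proof (Rabs_triang c d)
      end.
      replace ((h' + h' + (k' + k'))²) with (4 * (h' + k')²)
        by (unfold Rsqr; ring).
      lra. }
  destruct (nested_intervals (fun n => fst (c n)) h) as (u & Hu);
    [exact Hh | intros n; exact (proj1 (Hstep n (c n)))|].
  destruct (nested_intervals (fun n => snd (c n)) k) as (v & Hv);
    [exact Hk | intros n; exact (proj2 (Hstep n (c n)))|].
  destruct (rect_int_small g u v eps Heps) as (d & Hd & Hsmall).
  { pose proof (Hin 0%nat). specialize (Hu 0%nat). specialize (Hv 0%nat).
    apply Hdiff; simpl in *; lra. }
  (* For this [n] one has (h + k) / 2^n < d, also when h + k = 0. *)
  destruct (pow_lt_1_zero (/ 2) ltac:(rewrite Rabs_pos_eq; lra)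
              (d / (h + k + 1)) ltac:(apply Rdiv_lt_0_compat; lra)) as (n & Hn).
  specialize (Hn n (le_n n)). specialize (Hbad n).
  apply Rlt_not_le in Hbad. apply Hbad.
  pose proof (Hin n). pose proof (Hp n).
  apply Hsmall; try lra; auto.
  - rewrite pow_inv, Rabs_pos_eq in Hn
      by (left; apply Rinv_0_lt_compat; auto).
    replace (h / 2 ^ n + k / 2 ^ n) with ((h + k) * / 2 ^ n)
      by (field; specialize (H2 n); lra).
    assert (0 < / 2 ^ n) by (apply Rinv_0_lt_compat; auto).
    apply Rmult_lt_compat_r with (r := h + k + 1) in Hn; [|lra].
    unfold Rdiv in Hn. rewrite (Rmult_assoc d), Rinv_l in Hn by lra. nra.
  - intros s t ? ?. apply Hcont; lra.
Qed.

(** * The maximum modulus principle at the center of a disc *)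

Definition cexp (z : C) : C :=
  (exp (fst z) * cos (snd z), exp (fst z) * sin (snd z)).

Lemma cexp_plus (z w : C) : cexp (z + w) = (cexp z * cexp w)%C.
Proof.
  unfold cexp. apply injective_projections; simpl;
    rewrite exp_plus, ?cos_plus, ?sin_plus; ring.
Qed.

Lemma Cmod_cexp (z : C) : Cmod (cexp z) = exp (fst z).
Proof.
  unfold Cmod, cexp; cbn [fst snd].
  replace (_ + _) with ((exp (fst z))²).
  - apply sqrt_Rsqr, Rlt_le, exp_pos.
  - rewrite <- (Rmult_1_r (_²)), <- (sin2_cos2 (snd z)). unfold Rsqr. ring.
Qed.

Lemma derivable_pt_lim_0_expansion (f : R -> R) (l eps : R) :
  derivable_pt_lim f 0 l -> 0 < eps ->
  exists d, 0 < d /\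
    forall h, Rabs h < d -> Rabs (f h - f 0 - l * h) <= eps * Rabs h.
Proof.
  intros Hf He. destruct (Hf eps He) as (d & Hd).
  exists d. split; [apply cond_pos|]. intros h Hh.
  destruct (Req_dec h 0) as [->|Hn].
  - replace (f 0 - f 0 - l * 0) with 0 by ring. rewrite Rabs_R0. lra.
  - specialize (Hd h Hn Hh). rewrite Rplus_0_l in Hd.
    replace (f h - f 0 - l * h) with (((f h - f 0) / h - l) * h) by now field.
    rewrite Rabs_mult. apply Rmult_le_compat_r; [apply Rabs_pos | lra].
Qed.

(** The constant is 9 = 4 + 5. With z = (s, t), the real error al + exp s * be is at most (1 + 3)
    eps |z|, and the imaginary error (s + al) t + exp s * ga at most (2 + 3) eps |z|. Here |exp s|
    <= 3, and [d <= eps] makes the quadratic term small. *)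
Lemma cexp_expansion (eps : R) :
  0 < eps <= 1 ->
  exists d, 0 < d /\
    forall z, Cmod z < d -> Cmod (cexp z - 1 - z)%C <= 9 * eps * Cmod z.
Proof.
  intros He.
  destruct (derivable_pt_lim_0_expansion exp 1 eps derivable_pt_lim_exp_0)
    as (d1 & Hd1 & H1); [lra|].
  destruct (derivable_pt_lim_0_expansion cos _ eps (derivable_pt_lim_cos 0))
    as (d2 & Hd2 & H2); [lra|].
  destruct (derivable_pt_lim_0_expansion sin _ eps (derivable_pt_lim_sin 0))
    as (d3 & Hd3 & H3); [lra|].
  rewrite exp_0 in H1. rewrite sin_0, cos_0 in H2. rewrite sin_0, cos_0 in H3.
  set (d := Rmin eps (Rmin d1 (Rmin d2 d3))).
  assert (Hd : d <= eps /\ d <= d1 /\ d <= d2 /\ d <= d3).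
  { unfold d. pose proof (Rmin_l eps (Rmin d1 (Rmin d2 d3))).
    pose proof (Rmin_r eps (Rmin d1 (Rmin d2 d3))).
    pose proof (Rmin_l d1 (Rmin d2 d3)). pose proof (Rmin_r d1 (Rmin d2 d3)).
    pose proof (Rmin_l d2 d3). pose proof (Rmin_r d2 d3). lra. }
  exists d. split; [unfold d; repeat apply Rmin_pos; lra|].
  intros [s t] Hz.
  pose proof (fst_le_Cmod (s, t)) as Hs. pose proof (snd_le_Cmod (s, t)) as Ht.
  simpl in Hs, Ht. set (m := Cmod (s, t)) in *.
  specialize (H1 s ltac:(lra)). specialize (H2 t ltac:(lra)).
  specialize (H3 t ltac:(lra)).
  set (al := exp s - 1 - 1 * s) in *.
  set (be := cos t - 1 - - 0 * t) in *.
  set (ga := sin t - 0 - 1 * t) in *.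
  assert (Hes : exp s = 1 + s + al) by (unfold al; ring).
  assert (Hct : cos t = 1 + be) by (unfold be; ring).
  assert (Hst : sin t = t + ga) by (unfold ga; ring).
  assert (Hes3 : Rabs (exp s) <= 3).
  { rewrite Hes. pose proof (Rabs_triang (1 + s) al).
    pose proof (Rabs_triang 1 s). rewrite Rabs_R1 in *. nra. }
  eapply Rle_trans; [apply Cmod_le_abs|].
  pose proof (Rabs_pos s). pose proof (Rabs_pos t).
  pose proof (Rabs_pos al). pose proof (Rabs_pos be). pose proof (Rabs_pos ga).
  pose proof (Rabs_pos (exp s)).
  assert (E1 : Rabs (fst (cexp (s, t) - 1 - (s, t))%C) <= 4 * eps * m).
  { replace (fst (cexp (s, t) - 1 - (s, t))%C) with (al + exp s * be).
    2:{ simpl. rewrite Hct. rewrite Hes at 2. rewrite Hes. ring. }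
    eapply Rle_trans; [apply Rabs_triang|]. rewrite Rabs_mult. nra. }
  assert (E2 : Rabs (snd (cexp (s, t) - 1 - (s, t))%C) <= 5 * eps * m).
  { replace (snd (cexp (s, t) - 1 - (s, t))%C)
      with ((s + al) * t + exp s * ga).
    2:{ simpl. rewrite Hst. rewrite Hes. ring. }
    eapply Rle_trans; [apply Rabs_triang|]. rewrite !Rabs_mult.
    pose proof (Rabs_triang s al).
    assert (Rabs (s + al) <= 2 * eps) by nra.
    assert (Rabs (s + al) * Rabs t <= 2 * eps * m)
      by (apply Rmult_le_compat; auto using Rabs_pos).
    assert (Rabs (exp s) * Rabs ga <= 3 * (eps * m)) by
      (apply Rmult_le_compat; nra).
    lra. }
  lra.
Qed.

Lemma cdiff_cexp_0 : cdiff cexp 0.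
Proof.
  assert (E0 : cexp 0 = 1).
  { unfold cexp. simpl. rewrite exp_0, cos_0, sin_0.
    apply injective_projections; simpl; ring. }
  apply cdiff_slope.
  exists (fun z => if Ceq_dec z 0 then RtoC 1 else (cexp z - 1) / z)%C. split.
  - intros eps He.
    (* Nine times [eps / 18] is [eps / 2], which leaves room for the strict inequality. *)
    assert (Hm : 0 < Rmin 1 (eps / 18) <= 1)
      by (split; [apply Rmin_pos; lra | apply Rmin_l]).
    destruct (cexp_expansion _ Hm) as (d & Hd & Hz).
    exists d. split; [exact Hd|]. intros z Hzd.
    replace (z - 0)%C with z in Hzd by ring. specialize (Hz z Hzd).
    destruct (Ceq_dec 0 0) as [_|n]; [|now elim n].
    destruct (Ceq_dec z 0) as [->|n].
    { replace (1 - 1)%C with (RtoC 0) by ring. now rewrite Cmod_0. }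
    replace ((cexp z - 1) / z - 1)%C with ((cexp z - 1 - z) / z)%C by now field.
    rewrite Cmod_div by exact n. apply Cmod_gt_0 in n.
    apply Rmult_lt_reg_r with (Cmod z); [exact n|].
    unfold Rdiv. rewrite Rmult_assoc, Rinv_l by lra.
    pose proof (Rmin_r 1 (eps / 18)). nra.
  - intros z. rewrite E0. destruct (Ceq_dec z 0) as [->|n]; [rewrite E0; ring|].
    now field.
Qed.

(** The functional equation cexp y = cexp x * cexp (y - x) carries the slope at 0 to [x]. *)
Lemma cdiff_cexp (x : C) : cdiff cexp x.
Proof.
  assert (H : cdiff (fun y => cexp x * cexp (y - x))%C x).
  { apply cdiff_mult; [apply cdiff_const|].
    apply cdiff_comp with (g := cexp) (f := fun y => (y - x)%C).
    - apply cdiff_minus; [apply cdiff_id | apply cdiff_const].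
    - replace (x - x)%C with (RtoC 0) by ring. apply cdiff_cexp_0. }
  apply cdiff_slope in H. destruct H as (phi & Hc & Hphi).
  apply cdiff_slope. exists phi. split; [exact Hc|]. intros y.
  specialize (Hphi y). rewrite <- !cexp_plus in Hphi.
  replace (x + (y - x))%C with y in Hphi by ring.
  now replace (x + (x - x))%C with x in Hphi by ring.
Qed.

(* By Goursat on [s0, ln r] * [0, 2 PI] applied to f(p + exp zeta), whose
   horizontal sides cancel, the mean of Re f over the circle |x - p| = exp s
   is the same for s = s0 and s = ln r; near p it is close to Re f(p). *)
Lemma Re_max_circle (f : C -> C) (p : C) (r M : R) :
  0 < r -> (forall x, Cmod (x - p) <= r -> cdiff f x) ->
  (forall t, 0 <= t <= 2 * PI -> fst (f (p + cexp (ln r, t))%C) <= M) ->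
  fst (f p) <= M.
Proof.
  intros Hr Hf HM. apply Rnot_lt_le. intros Hlt.
  assert (He : 0 < (fst (f p) - M) / 2) by lra.
  assert (Hfp : cdiff f p).
  { apply Hf. replace (p - p)%C with (RtoC 0) by ring. rewrite Cmod_0. lra. }
  destruct (cdiff_ccont f p Hfp _ He) as (d & Hd & Hy).
  (* The inner circle has radius below [d], and the rectangle has nonnegative width. *)
  set (s0 := Rmin (ln r) (ln d - 1)).
  assert (Hs1 : s0 <= ln r) by apply Rmin_l.
  assert (Hs2 : exp s0 < d).
  { rewrite <- (exp_ln d) by exact Hd. apply exp_increasing.
    unfold s0. pose proof (Rmin_r (ln r) (ln d - 1)). lra. }
  set (g := fun z => f (p + cexp z)%C).
  pose proof PI_RGT_0 as HPI.
  assert (Hg : on_rect (cdiff g) s0 0 (ln r - s0) (2 * PI)).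
  { intros s t Hs _.
    apply cdiff_comp with (g := f) (f := fun z => (p + cexp z)%C).
    - apply cdiff_plus; [apply cdiff_const | apply cdiff_cexp].
    - apply Hf. replace (p + cexp (s, t) - p)%C with (cexp (s, t)) by ring.
      rewrite Cmod_cexp. simpl. rewrite <- (exp_ln r) by exact Hr.
      destruct (Rle_lt_or_eq_dec s (ln r)) as [L|E]; [lra| |].
      + left. now apply exp_increasing.
      + rewrite E. apply Rle_refl. }
  assert (HG := goursat g s0 0 (ln r - s0) (2 * PI) ltac:(lra) ltac:(lra) Hg).
  assert (Hc : on_rect (ccont g) s0 0 (ln r - s0) (2 * PI))
    by (intros s t ? ?; now apply cdiff_ccont, Hg).
  unfold rect_int in HG.
  rewrite (RInt_ext (fun s => snd (g (s, 0 + 2 * PI)) - snd (g (s, 0)))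
             (fun _ => 0)) in HG.
  2:{ intros s _. unfold g.
      replace (cexp (s, 0 + 2 * PI)) with (cexp (s, 0)); [apply Rminus_diag|].
      unfold cexp; cbn [fst snd].
      rewrite Rplus_0_l, cos_2PI, sin_2PI, cos_0, sin_0. reflexivity. }
  rewrite RInt_const in HG. unfold scal in HG; simpl in HG.
  unfold mult in HG; simpl in HG. rewrite Rmult_0_r, Rminus_0_r in HG.
  (* Re f is at most [M] on the outer circle and exceeds the midpoint of [M] and Re f(p) on the
     inner one, so the integrand is at most minus half the gap, whereas its integral is 0. *)
  assert (Hle : RInt (fun t => fst (g (s0 + (ln r - s0), t)) - fst (g (s0, t)))
             0 (0 + 2 * PI) <= RInt (fun _ => - ((fst (f p) - M) / 2))
             0 (0 + 2 * PI)).
  { apply RInt_le; [lra| |apply ex_RInt_const|].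
    - apply (ex_RInt_minus (V := R_CompleteNormedModule));
        apply ex_RInt_ver with (x := s0) (h := ln r - s0); auto; lra.
    - intros t Ht.
      replace (s0 + (ln r - s0)) with (ln r) by ring.
      assert (H1 : fst (g (ln r, t)) <= M).
      { apply HM. lra. }
      assert (H2 : Cmod (g (s0, t) - f p) < (fst (f p) - M) / 2).
      { apply Hy. replace (p + cexp (s0, t) - p)%C with (cexp (s0, t)) by ring.
        now rewrite Cmod_cexp. }
      pose proof (fst_le_Cmod (g (s0, t) - f p)) as H3.
      apply Rabs_le_between in H3. simpl in H3. lra. }
  rewrite HG, RInt_const in Hle. unfold scal in Hle; simpl in Hle.
  unfold mult in Hle; simpl in Hle. nra.
Qed.

Lemma Cmod_circle (p : C) (r t : R) :
  0 < r -> Cmod (p + cexp (ln r, t) - p) = r.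
Proof.
  intros Hr. replace (p + cexp (ln r, t) - p)%C with (cexp (ln r, t)) by ring.
  rewrite Cmod_cexp. now apply exp_ln.
Qed.

(** Multiplication by a unimodular constant makes f(p) real and nonnegative, which reduces the claim
    to real parts. The bound on the circle is assumed along its parametrization because [circle_min]
    provides it in that form. *)
Lemma max_circle (f : C -> C) (p : C) (r M : R) :
  0 < r -> (forall x, Cmod (x - p) <= r -> cdiff f x) ->
  (forall t, 0 <= t <= 2 * PI -> Cmod (f (p + cexp (ln r, t))%C) <= M) ->
  Cmod (f p) <= M.
Proof.
  intros Hr Hf HM.
  destruct (Ceq_dec (f p) 0) as [E|Hn].
  - rewrite E, Cmod_0.
    eapply Rle_trans; [apply Cmod_ge_0 | apply (HM 0)].
    pose proof PI_RGT_0. lra.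
  - apply Cmod_gt_0 in Hn.
    set (c := (Cconj (f p) / Cmod (f p))%C).
    assert (Hn' : RtoC (Cmod (f p)) <> 0) by (intros E; apply RtoC_inj in E; lra).
    assert (Hc1 : Cmod c = 1).
    { unfold c. rewrite Cmod_div, Cmod_conj, Cmod_R by exact Hn'.
      rewrite Rabs_pos_eq by lra. field. lra. }
    assert (Hc2 : (c * f p)%C = Cmod (f p)).
    { unfold c. replace (Cconj (f p) / Cmod (f p) * f p)%C
        with ((f p * Cconj (f p)) / Cmod (f p))%C by now field.
      rewrite <- Cmod2_conj, RtoC_pow. now field. }
    replace (Cmod (f p)) with (fst (c * f p)%C) by (rewrite Hc2; reflexivity).
    apply (Re_max_circle (fun x => c * f x)%C p r M Hr).
    + intros x Hx. apply cdiff_mult; [apply cdiff_const | now apply Hf].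
    + intros t Ht. eapply Rle_trans; [apply Rle_abs|].
      eapply Rle_trans; [apply fst_le_Cmod|].
      rewrite Cmod_mult, Hc1, Rmult_1_l. now apply HM.
Qed.

Lemma max_center (f : C -> C) (p : C) (r M : R) :
  0 < r -> (forall x, Cmod (x - p) <= r -> cdiff f x) ->
  (forall x, Cmod (x - p) = r -> Cmod (f x) <= M) -> Cmod (f p) <= M.
Proof.
  intros Hr Hf HM. apply (max_circle f p r M Hr Hf).
  intros t _. apply HM. now apply Cmod_circle.
Qed.

(** * Compact and removable sets *)

(** The balls behind [open] are squares; the one of half-side [d / sqrt 2] lies in the disc of
    radius [d]. *)
Lemma open_Cmod (G : C -> Prop) :
  open G <->
  forall x, G x -> exists d, 0 < d /\ forall y, Cmod (y - x) < d -> G y.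
Proof.
  split.
  - intros HG x Hx. destruct (HG x Hx) as (d & Hd).
    exists d. split; [apply cond_pos|]. intros y Hy.
    apply Hd. now apply C_NormedModule_mixin_compat1.
  - intros HG x Hx. destruct (HG x Hx) as (d & Hd & Hy).
    assert (Hs : 0 < sqrt 2) by (apply sqrt_lt_R0; lra).
    assert (Hd2 : 0 < d / sqrt 2) by now apply Rdiv_lt_0_compat.
    exists (mkposreal _ Hd2). intros y Hb. apply Hy.
    apply C_NormedModule_mixin_compat2 in Hb.
    replace d with (sqrt 2 * mkposreal _ Hd2); [exact Hb|].
    simpl. field. lra.
Qed.

Lemma open_disc (x : C) (r : R) : open (fun y => Cmod (y - x) < r).
Proof.
  apply open_Cmod. intros y Hy. exists (r - Cmod (y - x)). split; [lra|].
  intros y' Hy'. pose proof (Cmod_triangle (y' - y) (y - x)) as H.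
  replace (y' - y + (y - x))%C with (y' - x)%C in H by ring. lra.
Qed.

Lemma open_disc_exterior (x : C) (r : R) : open (fun y => r < Cmod (y - x)).
Proof.
  apply open_Cmod. intros y Hy. exists (Cmod (y - x) - r). split; [lra|].
  intros y' Hy'. pose proof (Cmod_minus_ge (y - x) (y - y')) as H.
  rewrite (Cmod_minus_sym y y') in H.
  replace (y - x - (y - y'))%C with (y' - x)%C in H by ring. lra.
Qed.

Lemma compact_increasing_cover (K : C -> Prop) (V : nat -> C -> Prop) :
  compact_set K -> (forall n, open (V n)) ->
  (forall n m z, (n <= m)%nat -> V n z -> V m z) ->
  (forall z, K z -> exists n, V n z) -> exists n, subset K (V n).
Proof.
  intros HK HV Hinc Hcov. destruct (HK nat V HV Hcov) as (l & Hl).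
  exists (list_max l). intros z Hz. destruct (Hl z Hz) as (n & Hn & Hnz).
  apply (Hinc n); [|exact Hnz].
  pose proof (proj1 (list_max_le l _) (le_n _)) as HF.
  now apply (proj1 (Forall_forall _ _) HF).
Qed.

Lemma compact_bounded (K : C -> Prop) (w : C) :
  compact_set K -> exists r, 0 < r /\ forall z, K z -> Cmod (z - w) < r.
Proof.
  intros HK.
  destruct (compact_increasing_cover K (fun n z => Cmod (z - w) < INR n + 1) HK)
    as (n & Hn).
  - intros n. apply open_disc.
  - intros n m z Hnm%le_INR Hz. lra.
  - intros z _. destruct (INR_archimed 1 (Cmod (z - w))) as (n & Hn); [lra|].
    exists n. lra.
  - exists (INR n + 1). split; [pose proof (pos_INR n); lra | exact Hn].
Qed.

(** The exteriors of the discs of radius 1 / (n + 1) about [x] cover [K]; by compactness one of them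
    does. *)
Lemma compact_closed (K : C -> Prop) (x : C) :
  compact_set K -> ~ K x ->
  exists d, 0 < d /\ forall y, Cmod (y - x) < d -> ~ K y.
Proof.
  intros HK Hx.
  assert (Hpos : forall n, 0 < INR n + 1) by (intros n; pose proof (pos_INR n); lra).
  destruct (compact_increasing_cover K (fun n z => / (INR n + 1) < Cmod (z - x)) HK)
    as (n & Hn).
  - intros n. apply open_disc_exterior.
  - intros n m z Hnm%le_INR Hz. eapply Rle_lt_trans; [|exact Hz].
    specialize (Hpos n). apply Rinv_le_contravar; lra.
  - intros z Hz.
    assert (Hp : 0 < Cmod (z - x)).
    { apply Cmod_gt_0. intros E. apply Hx. now rewrite <- (Cminus_eq_0 z x E). }
    destruct (INR_archimed _ 1 Hp) as (n & Hn). exists n. specialize (Hpos n).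
    apply Rmult_lt_reg_l with (INR n + 1); [exact Hpos|].
    rewrite Rinv_r by lra. lra.
  - exists (/ (INR n + 1)). split; [now apply Rinv_0_lt_compat|].
    intros y Hy Ky. apply Hn in Ky. lra.
Qed.

(* Otherwise a disc around w is contained in K, so that 1/(x - w) is bounded
   off K; if g is its entire extension, 1 - (x - w) g(x) vanishes off K and
   equals 1 at w, against the maximum modulus principle on a large disc. *)
Lemma removable_dense_complement (K : C -> Prop) (w : C) (d : R) :
  removable K -> 0 < d -> exists y, Cmod (y - w) < d /\ ~ K y.
Proof.
  intros [Hcomp Hrem] Hd. apply NNPP. intros Hno.
  assert (HK : forall y, Cmod (y - w) < d -> K y).
  { intros y Hy. apply NNPP. intros Hn. apply Hno. now exists y. }
  assert (Hne : forall y, ~ K y -> (y - w)%C <> 0).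
  { intros y Hy E. apply Hy, HK. rewrite E, Cmod_0. exact Hd. }
  destruct (Hrem (fun _ => True)) with (f := fun x => (/ (x - w))%C)
    as (g & Hg & Hgf).
  - apply open_true.
  - easy.
  - intros y [_ Hy]. apply cdiff_inv; [now apply Hne|].
    apply cdiff_minus; [apply cdiff_id | apply cdiff_const].
  - exists (/ d). intros y [_ Hy]. rewrite Cmod_inv by now apply Hne.
    apply Rinv_le_contravar; [exact Hd|].
    apply Rnot_lt_le. intros L. now apply Hy, HK.
  - destruct (compact_bounded K w Hcomp) as (r & Hr & HKr).
    pose proof (max_center (fun x => 1 - (x - w) * g x)%C w r 0 Hr) as Hmax.
    cbv beta in Hmax.
    replace (1 - (w - w) * g w)%C with (RtoC 1) in Hmax by ring.
    rewrite Cmod_1 in Hmax.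
    assert (1 <= 0); [|lra]. apply Hmax.
    + intros x _. apply cdiff_minus; [apply cdiff_const|].
      apply cdiff_mult; [|now apply Hg].
      apply cdiff_minus; [apply cdiff_id | apply cdiff_const].
    + intros x Hx.
      assert (Kx : ~ K x) by (intros Kx; apply HKr in Kx; lra).
      rewrite Hgf by now split.
      replace (1 - (x - w) * / (x - w))%C with (RtoC 0).
      2:{ field. now apply Hne. }
      rewrite Cmod_0. lra.
Qed.

(** * Open mapping *)

Lemma Cmod_lipschitz (x y : C) : Rabs (Cmod x - Cmod y) <= Cmod (x - y).
Proof.
  apply Rabs_le. pose proof (Cmod_minus_ge x y). pose proof (Cmod_minus_ge y x).
  rewrite (Cmod_minus_sym y x) in *. lra.
Qed.

Lemma circle_min (f : C -> C) (p : C) (r : R) :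
  0 < r -> (forall x, Cmod (x - p) = r -> ccont f x) ->
  exists y, Cmod (y - p) = r /\ forall t, 0 <= t <= 2 * PI ->
    Cmod (f y) <= Cmod (f (p + cexp (ln r, t))%C).
Proof.
  intros Hr Hf. pose proof PI_RGT_0.
  destruct (continuity_ab_min (fun t => Cmod (f (p + cexp (ln r, t))%C)) 0 (2 * PI))
    as (t0 & Hmin & _); [lra| |].
  - intros t _. apply continuity_pt_filterlim.
    apply (proj2 (filterlim_locally (U := R_UniformSpace) _ _)). intros eps.
    assert (Hc : ccont (fun z => f (p + cexp z)%C) (ln r, t)).
    { apply ccont_comp with (g := f) (f := fun z => (p + cexp z)%C).
      - apply ccont_plus; [apply ccont_const | apply cdiff_ccont, cdiff_cexp].
      - apply Hf. now apply Cmod_circle. }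
    destruct (Hc eps (cond_pos eps)) as (d & Hd & Hy).
    exists (mkposreal d Hd). intros s Hs.
    eapply Rle_lt_trans; [apply Cmod_lipschitz|]. apply Hy.
    rewrite Cmod_ver. exact Hs.
  - exists (p + cexp (ln r, t0))%C. split; [now apply Cmod_circle | exact Hmin].
Qed.

(* If c near f(x) were not taken, 1/(f - c) would be larger at x than on the
   circle. *)
Lemma open_mapping (f : C -> C) (x : C) (r : R) :
  0 < r -> (forall y, Cmod (y - x) <= r -> cdiff f y) ->
  (forall y, Cmod (y - x) = r -> f y <> f x) ->
  exists eta, 0 < eta /\ forall c, Cmod (c - f x) < eta ->
    exists y, Cmod (y - x) <= r /\ f y = c.
Proof.
  intros Hr Hf Hinj.
  destruct (circle_min (fun y => f y - f x)%C x r Hr) as (y0 & Hy0 & Hmin).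
  { intros y Hy. apply ccont_minus; [|apply ccont_const].
    apply cdiff_ccont, Hf. lra. }
  set (m := Cmod (f y0 - f x)) in *.
  assert (Hm : 0 < m).
  { apply Cmod_gt_0. intros E. now apply (Hinj y0 Hy0), Cminus_eq_0. }
  (* On the circle |f - c| >= m - |c - f x| > m / 2, while at the centre |f x - c| < m / 2. *)
  exists (m / 2). split; [lra|]. intros c Hc. apply NNPP. intros Hno.
  assert (Hfc : forall y, Cmod (y - x) <= r -> (f y - c)%C <> 0).
  { intros y Hy E. apply Hno. exists y. split; [exact Hy|]. now apply Cminus_eq_0. }
  assert (Hmax : Cmod (/ (f x - c)) <= / (m - Cmod (c - f x))).
  { apply (max_circle (fun y => / (f y - c))%C x r _ Hr).
    - intros y Hy. apply cdiff_inv; [now apply Hfc|].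
      apply cdiff_minus; [now apply Hf | apply cdiff_const].
    - intros t Ht. rewrite Cmod_inv by (apply Hfc; rewrite Cmod_circle; lra).
      apply Rinv_le_contravar; [lra|].
      specialize (Hmin t Ht).
      set (v := f (x + cexp (ln r, t))%C) in *.
      pose proof (Cmod_minus_ge (v - f x) (c - f x)) as H.
      replace (v - f x - (c - f x))%C with (v - c)%C in H by ring.
      lra. }
  assert (Hx : (f x - c)%C <> 0).
  { apply Hfc. replace (x - x)%C with (RtoC 0) by ring. rewrite Cmod_0. lra. }
  rewrite Cmod_inv, Cmod_minus_sym in Hmax by exact Hx.
  apply Cmod_gt_0 in Hx. rewrite Cmod_minus_sym in Hx.
  apply Rinv_lt_contravar in Hc as Hc'; [|nra].
  assert (/ (m - Cmod (c - f x)) < / (m / 2)); [|lra].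
  apply Rinv_lt_contravar; nra.
Qed.

(** * Local Schwarz-Pick estimate *)

(** For [a] and [w] in the unit disc the right side is nonnegative, so w -> (w - a) / (1 - conj(a)
    w) maps the disc to itself. *)
Lemma mobius_identity (a w : C) :
  Cmod (1 - Cconj a * w) ^ 2 - Cmod (w - a) ^ 2 =
  (1 - Cmod a ^ 2) * (1 - Cmod w ^ 2).
Proof.
  rewrite !Cmod2_alt. destruct a as [a1 a2], w as [w1 w2].
  unfold Re, Im; simpl. ring.
Qed.

Lemma mobius_denominator (a w : C) (c : R) :
  Cmod a <= c -> Cmod w < 1 -> 1 - c <= Cmod (1 - Cconj a * w).
Proof.
  intros Ha Hw. pose proof (Cmod_minus_ge 1 (Cconj a * w)) as H.
  rewrite Cmod_1, Cmod_mult, Cmod_conj in H.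
  pose proof (Cmod_ge_0 a). pose proof (Cmod_ge_0 w). nra.
Qed.

(** If h(y) = phi(y) (y - p), the quotient is phi(y)² (y - p), with slope phi². At [y = p] both
    vanish, whatever value [/ 0] takes. *)
Lemma cdiff_square_div (h : C -> C) (p : C) :
  cdiff h p -> h p = 0 -> cdiff (fun y => h y * h y / (y - p))%C p.
Proof.
  intros Hh H0. apply cdiff_slope in Hh. destruct Hh as (phi & Hc & Hphi).
  apply cdiff_slope. exists (fun y => phi y * phi y)%C.
  split; [now apply ccont_mult|].
  intros y. rewrite H0. rewrite (Hphi y), H0.
  destruct (Ceq_dec y p) as [->|Hn].
  - unfold Cdiv. ring.
  - unfold Cdiv. rewrite !Cmult_0_l, !Cplus_0_l. field.
    intros E. now apply Hn, Cminus_eq_0.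
Qed.

(* Instead of Schwarz's lemma for h(x)/(x - p), where h is f followed by the
   disc automorphism sending f(p) to 0, the maximum principle is applied to
   h(x)^2/(x - p), which is visibly differentiable at p. *)
Lemma schwarz_pick_local (f : C -> C) (p q : C) (r c : R) :
  0 < r -> (forall x, Cmod (x - q) <= r -> cdiff f x /\ Cmod (f x) < 1) ->
  3 * Cmod (p - q) <= r -> Cmod (f p) <= c -> c < 1 ->
  Cmod (f q) ^ 2 <= 1 - (1 - c) ^ 2 / 2.
Proof.
  intros Hr Hf Hpq Hc Hc1.
  pose proof (Cmod_ge_0 (p - q)) as Hpq0. pose proof (Cmod_ge_0 (f p)) as Hfp0.
  destruct (Ceq_dec p q) as [->|Hne]; [pose proof (Cmod_ge_0 (f q)); nra|].
  assert (Hq : Cmod (f q) < 1).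
  { apply Hf. replace (q - q)%C with (RtoC 0) by ring. rewrite Cmod_0. lra. }
  set (a := f p) in *.
  set (D := fun y => (1 - Cconj a * f y)%C).
  set (h := fun y => ((f y - a) / D y)%C).
  assert (HD : forall y, Cmod (f y) < 1 -> 1 - c <= Cmod (D y))
    by (intros y Hy; now apply mobius_denominator).
  assert (HD0 : forall y, Cmod (f y) < 1 -> D y <> 0)
    by (intros y Hy; specialize (HD y Hy); apply Cmod_gt_0; lra).
  assert (Hid : forall y, Cmod (D y) ^ 2 - Cmod (f y - a) ^ 2 =
                 (1 - Cmod a ^ 2) * (1 - Cmod (f y) ^ 2))
    by (intros y; apply mobius_identity).
  assert (Hh1 : forall y, Cmod (f y) < 1 -> Cmod (h y) <= 1).
  { intros y Hy. unfold h. rewrite Cmod_div by now apply HD0.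
    specialize (Hid y). specialize (HD y Hy).
    pose proof (Cmod_ge_0 (f y)). pose proof (Cmod_ge_0 (f y - a)).
    apply Rle_div_l; [lra|]. rewrite Rmult_1_l.
    apply Rsqr_incr_0; [|lra..]. rewrite !Rsqr_pow2.
    assert (0 <= (1 - Cmod a ^ 2) * (1 - Cmod (f y) ^ 2))
      by (apply Rmult_le_pos; nra). lra. }
  assert (Hhd : forall y, Cmod (y - q) <= r -> cdiff h y).
  { intros y Hy. destruct (Hf y Hy) as [Hd Hl].
    apply cdiff_mult.
    - apply cdiff_minus; [exact Hd | apply cdiff_const].
    - apply cdiff_inv; [now apply HD0|].
      apply cdiff_minus; [apply cdiff_const|].
      apply cdiff_mult; [apply cdiff_const | exact Hd]. }
  assert (Hhp : h p = 0).
  { unfold h. fold a. replace (a - a)%C with (RtoC 0) by ring.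
    unfold Cdiv. ring. }
  assert (Hsub : forall y, y <> p -> (y - p)%C <> 0)
    by (intros y Hy E; now apply Hy, Cminus_eq_0).
  assert (Hmax : Cmod (h q * h q / (q - p)) <= / (r - Cmod (p - q))).
  { apply (max_center (fun y => h y * h y / (y - p))%C q r _ Hr).
    - intros y Hy. destruct (Ceq_dec y p) as [->|Hn].
      + apply cdiff_square_div; [now apply Hhd | exact Hhp].
      + apply cdiff_mult; [apply cdiff_mult; now apply Hhd|].
        apply cdiff_inv; [now apply Hsub|].
        apply cdiff_minus; [apply cdiff_id | apply cdiff_const].
    - intros y Hy.
      pose proof (Cmod_minus_ge (y - q) (p - q)) as Ht.
      replace (y - q - (p - q))%C with (y - p)%C in Ht by ring. rewrite Hy in Ht.
      assert (Hyp : (y - p)%C <> 0) by (apply Cmod_gt_0; lra).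
      rewrite Cmod_div, Cmod_mult by exact Hyp.
      assert (Hhy : Cmod (h y) <= 1) by (apply Hh1, Hf; lra).
      pose proof (Cmod_ge_0 (h y)).
      assert (0 < / Cmod (y - p)) by (apply Rinv_0_lt_compat; lra).
      apply Rle_trans with (/ Cmod (y - p)).
      + rewrite <- (Rmult_1_l (/ Cmod (y - p))). apply Rmult_le_compat_r; nra.
      + apply Rinv_le_contravar; lra. }
  assert (Hqp : 0 < Cmod (p - q)).
  { apply Cmod_gt_0. intros E. now apply Hne, Cminus_eq_0. }
  rewrite Cmod_div, Cmod_mult in Hmax by (apply Hsub; congruence).
  rewrite (Cmod_minus_sym q p) in Hmax.
  (* |h q|² <= |p - q| / (r - |p - q|), and 3 |p - q| <= r bounds this by 1/2. *)
  assert (Hhalf : Cmod (h q) * Cmod (h q) <= / 2).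
  { apply Rle_div_l in Hmax; [|exact Hqp]. eapply Rle_trans; [exact Hmax|].
    apply Rmult_le_reg_l with (r - Cmod (p - q)); [lra|].
    rewrite <- Rmult_assoc, Rinv_r by lra. lra. }
  specialize (HD q Hq). specialize (HD0 q Hq). specialize (Hid q).
  assert (Hn : Cmod (f q - a) ^ 2 <= / 2 * Cmod (D q) ^ 2).
  { replace (Cmod (f q - a)) with (Cmod (h q) * Cmod (D q)).
    - rewrite Rpow_mult_distr. apply Rmult_le_compat_r; [apply pow2_ge_0|].
      simpl. lra.
    - rewrite <- Cmod_mult. f_equal. unfold h. now field. }
  pose proof (Cmod_ge_0 (f q)).
  (* The identity gives (1 - |a|²)(1 - |f q|²) >= |D q|² / 2 >= (1 - c)² / 2, and the factor 1 -
     |a|² is at most 1. *)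
  assert ((1 - c) ^ 2 <= Cmod (D q) ^ 2) by (apply pow_incr; lra).
  assert (0 <= Cmod a ^ 2 * (1 - Cmod (f q) ^ 2))
    by (apply Rmult_le_pos; [apply pow2_ge_0 | nra]).
  lra.
Qed.

(** * The Caratheodory pseudodistance *)

Lemma hol_to_disc_0 (G : C -> Prop) : hol_to_disc G (fun _ => RtoC 0).
Proof.
  split; intros x _; [apply cdiff_const|]. unfold disc0. rewrite Cmod_0. lra.
Qed.

Lemma disc_maps_bound_step (G : C -> Prop) (z p q : C) (r : R) :
  0 < r -> (forall x, Cmod (x - q) <= r -> G x) -> 3 * Cmod (p - q) <= r ->
  (exists c, c < 1 /\
     forall f, hol_to_disc G f -> f z = RtoC 0 -> Cmod (f p) <= c) ->
  exists c, c < 1 /\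
     forall f, hol_to_disc G f -> f z = RtoC 0 -> Cmod (f q) <= c.
Proof.
  intros Hr HG Hpq (c & Hc & Hp).
  assert (H1 : 0 < (1 - c) ^ 2) by (apply pow_lt; lra).
  exists (sqrt (1 - (1 - c) ^ 2 / 2)). split.
  - apply Rlt_le_trans with (sqrt 1); [|rewrite sqrt_1; lra].
    apply sqrt_lt_1_alt. split; [|lra].
    (* The zero map shows [0 <= c], so the radicand is nonnegative. *)
    pose proof (Hp _ (hol_to_disc_0 G) eq_refl) as Hc0. cbv beta in Hc0.
    rewrite Cmod_0 in Hc0. nra.
  - intros f Hf Hz.
    rewrite <- (sqrt_pow2 (Cmod (f q))) by apply Cmod_ge_0.
    apply sqrt_le_1_alt.
    apply schwarz_pick_local with (p := p) (r := r); auto.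
    intros x Hx. split; apply Hf; now apply HG.
Qed.

(** The existence of a uniform bound below 1 is a locally constant property of the point and holds
    at [z]; connectedness spreads it over [G]. *)
Lemma disc_maps_bound (G : C -> Prop) (z w : C) :
  is_domain G -> G z -> G w ->
  exists c, c < 1 /\
    forall f, hol_to_disc G f -> f z = RtoC 0 -> Cmod (f w) <= c.
Proof.
  intros (_ & HG & Hconn) Hz Hw.
  set (P := fun x => exists c, c < 1 /\
    forall f, hol_to_disc G f -> f z = RtoC 0 -> Cmod (f x) <= c).
  change (P w). apply NNPP. intros Hno.
  assert (Hstep : forall x, G x -> exists d, 0 < d /\ forall y, Cmod (y - x) < d ->
                    G y /\ (P x <-> P y)).
  { intros x Hx. destruct (proj1 (open_Cmod G) HG x Hx) as (d & Hd & Hy).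
    (* Discs of radius d / 2 about [x] and about [y] both lie in [G], and 3 * (d / 6) = d / 2, so
       the step works in either direction. *)
    exists (d / 6). split; [lra|]. intros y Hyx. split; [apply Hy; lra|].
    split; apply disc_maps_bound_step with (r := d / 2); try lra.
    - intros u Hu. apply Hy. pose proof (Cmod_triangle (u - y) (y - x)) as H.
      replace (u - y + (y - x))%C with (u - x)%C in H by ring. lra.
    - rewrite Cmod_minus_sym. lra.
    - intros u Hu. apply Hy. lra. }
  destruct (Hconn (fun x => G x /\ P x) (fun x => G x /\ ~ P x))
    as (x & _ & [_ H1] & [_ H2]); [| | | | |now apply H2].
  - apply open_Cmod. intros x [Hx HP]. destruct (Hstep x Hx) as (d & Hd & Hy).
    exists d. split; [exact Hd|]. intros y Hyd.
    destruct (Hy y Hyd) as [? ?]. tauto.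
  - apply open_Cmod. intros x [Hx HP]. destruct (Hstep x Hx) as (d & Hd & Hy).
    exists d. split; [exact Hd|]. intros y Hyd.
    destruct (Hy y Hyd) as [? ?]. tauto.
  - intros x Hx. destruct (classic (P x)); auto.
  - exists z. repeat split; auto. exists 0. split; [lra|].
    intros f _ E. rewrite E, Cmod_0. lra.
  - exists w. auto.
Qed.

Lemma tanh_exp (t : R) : tanh t = 1 - 2 / (exp t * exp t + 1).
Proof.
  unfold tanh, sinh, cosh. rewrite exp_Ropp. pose proof (exp_pos t).
  field. split; nra.
Qed.

Lemma tanh_increasing (s t : R) : s < t -> tanh s < tanh t.
Proof.
  intros Hst. rewrite !tanh_exp.
  apply exp_increasing in Hst. pose proof (exp_pos s).
  assert (/ (exp t * exp t + 1) < / (exp s * exp s + 1))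
    by (apply Rinv_lt_contravar; nra).
  unfold Rdiv. lra.
Qed.

Lemma tanh_le (s t : R) : s <= t -> tanh s <= tanh t.
Proof.
  intros [L|E]; [left; now apply tanh_increasing | rewrite E; apply Rle_refl].
Qed.

Lemma tanh_artanh (x : R) : -1 < x < 1 -> tanh (artanh x) = x.
Proof.
  intros Hx. rewrite tanh_exp, <- exp_plus. unfold artanh.
  replace (_ / 2 + _ / 2) with (ln ((1 + x) / (1 - x))) by field.
  rewrite exp_ln by (apply Rdiv_lt_0_compat; lra). field. lra.
Qed.

Lemma artanh_lt (x a : R) : -1 < x < 1 -> a < artanh x <-> tanh a < x.
Proof.
  intros Hx. split; intros H.
  - rewrite <- (tanh_artanh x Hx). now apply tanh_increasing.
  - apply Rnot_le_lt. intros L. apply tanh_le in L.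
    rewrite tanh_artanh in L by exact Hx. lra.
Qed.

Lemma artanh_le (x y : R) : -1 < x -> x <= y -> y < 1 -> artanh x <= artanh y.
Proof.
  intros Hx Hxy Hy. apply Rnot_lt_le. intros L.
  apply artanh_lt in L; [|lra]. rewrite tanh_artanh in L; lra.
Qed.

(** [0 <= M] covers an empty [E], whose least upper bound [m_infty] becomes 0 under [real]. No
    injective map into the disc has to be exhibited to bound [squeezing]. *)
Lemma Rsup_le (E : R -> Prop) (M : R) :
  0 <= M -> (forall x, E x -> x <= M) -> Rsup E <= M.
Proof.
  intros HM HE. unfold Rsup.
  destruct (Lub_Rbar_correct E) as [_ Hl].
  specialize (Hl (Finite M) (fun x Hx => HE x Hx)).
  destruct (Lub_Rbar E); simpl in *; [exact Hl | easy | exact HM].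
Qed.

Lemma Rsup_is_lub (E : R -> Prop) (M : R) :
  (exists x, E x) -> (forall x, E x -> x <= M) -> is_lub E (Rsup E).
Proof.
  intros (x0 & Hx0) HE. unfold Rsup.
  destruct (Lub_Rbar_correct E) as [Hu Hl].
  specialize (Hl (Finite M) (fun x Hx => HE x Hx)) as HlM.
  pose proof (Hu x0 Hx0) as Hu0.
  destruct (Lub_Rbar E) as [l| |]; simpl in *; try easy.
  split.
  - intros x Hx. exact (Hu x Hx).
  - intros b Hb. exact (Hl (Finite b) (fun x Hx => Hb x Hx)).
Qed.

Lemma caratheodory_is_lub (G : C -> Prop) (z w : C) :
  is_domain G -> G z -> G w ->
  is_lub (fun a => exists f : C -> C,
            hol_to_disc G f /\ f z = RtoC 0 /\ a = artanh (Cmod (f w)))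
    (caratheodory G z w).
Proof.
  intros HG Hz Hw. destruct (disc_maps_bound G z w HG Hz Hw) as (c & Hc & Hf).
  apply Rsup_is_lub with (M := artanh c).
  - exists (artanh (Cmod (RtoC 0))), (fun _ => RtoC 0).
    repeat split; apply hol_to_disc_0.
  - intros a (f & Hhol & H0 & ->). pose proof (Cmod_ge_0 (f w)).
    apply artanh_le; [lra | now apply Hf | exact Hc].
Qed.

Lemma Cmod_le_tanh_caratheodory (G : C -> Prop) (z w : C) (f : C -> C) :
  is_domain G -> G z -> G w -> hol_to_disc G f -> f z = RtoC 0 ->
  Cmod (f w) <= tanh (caratheodory G z w).
Proof.
  intros HG Hz Hw Hf H0. pose proof (Cmod_ge_0 (f w)).
  rewrite <- (tanh_artanh (Cmod (f w))).
  2:{ split; [lra | now apply Hf]. }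
  apply tanh_le, (caratheodory_is_lub G z w HG Hz Hw). now exists f.
Qed.

Lemma caratheodory_lsc (G : C -> Prop) (z w : C) (a : R) :
  is_domain G -> G z -> G w -> a < caratheodory G z w ->
  exists d, 0 < d /\
    forall y, Cmod (y - w) < d -> G y -> a < caratheodory G z y.
Proof.
  intros HG Hz Hw Ha.
  assert (Hf : exists f, hol_to_disc G f /\ f z = RtoC 0 /\
                         a < artanh (Cmod (f w))).
  { apply NNPP. intros Hno. apply Rlt_not_le in Ha. apply Ha.
    apply (caratheodory_is_lub G z w HG Hz Hw).
    intros b (f & Hf & H0 & ->). apply Rnot_lt_le. intros L.
    apply Hno. now exists f. }
  destruct Hf as (f & Hf & H0 & Hafw).
  assert (Hmod : forall y, G y -> -1 < Cmod (f y) < 1).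
  { intros y Hy. pose proof (Cmod_ge_0 (f y)). split; [lra|]. now apply Hf. }
  (* Comparing moduli with [tanh a] leaves only the continuity of [f] to be used. *)
  apply artanh_lt in Hafw; [|now apply Hmod].
  destruct (cdiff_ccont f w (proj1 Hf w Hw) (Cmod (f w) - tanh a)) as (d & Hd & Hy);
    [lra|].
  exists d. split; [exact Hd|]. intros y Hyd Gy. specialize (Hy y Hyd).
  apply Rlt_le_trans with (artanh (Cmod (f y))).
  - apply artanh_lt; [now apply Hmod|].
    pose proof (Cmod_minus_ge (f w) (f y)) as H.
    rewrite Cmod_minus_sym in H. lra.
  - apply (caratheodory_is_lub G z y HG Hz Gy). now exists f.
Qed.

Lemma list_argmin (A : Type) (phi : A -> R) (l : list A) (i : A) :
  In i l -> exists m, In m l /\ forall j, In j l -> phi m <= phi j.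
Proof.
  revert i. induction l as [|x l IH]; [easy|]. intros _ _.
  destruct l as [|x' l'].
  - exists x. split; [now left|]. intros j [->|[]]. apply Rle_refl.
  - destruct (IH x') as (m & Hm & Hmin); [now left|].
    destruct (Rle_dec (phi x) (phi m)) as [L|L].
    + exists x. split; [now left|].
      intros j [->|Hj]; [lra|]. specialize (Hmin j Hj). lra.
    + exists m. split; [now right|].
      intros j [->|Hj]; [lra|]. now apply Hmin.
Qed.

(** Without a minimum, the regions where phi > phi(i), for i in [K], cover [K]; in a finite subcover
    the centre [i] of least value lies in none of them. *)
Lemma lsc_attains_min (K : C -> Prop) (phi : C -> R) :
  compact_set K -> (exists w, K w) ->
  (forall w a, K w -> a < phi w -> exists d, 0 < d /\
     forall y, Cmod (y - w) < d -> K y -> a < phi y) ->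
  exists w0, K w0 /\ forall w, K w -> phi w0 <= phi w.
Proof.
  intros HK [w Hw] Hlsc. apply NNPP. intros Hno.
  assert (Hlt : forall x, K x -> exists i, K i /\ phi i < phi x).
  { intros x Hx. apply NNPP. intros Hn. apply Hno. exists x. split; [exact Hx|].
    intros i Hi. apply Rnot_lt_le. intros L. apply Hn. now exists i. }
  (* The set phi > phi(i) is only relatively open in [K]; requiring the inequality on [K] near [x]
     gives an open subset of the plane. *)
  destruct (HK {i : C | K i} (fun i x => exists d, 0 < d /\
     forall y, Cmod (y - x) < d -> K y -> phi (proj1_sig i) < phi y))
    as (l & Hl).
  - intros i. apply open_Cmod. intros x (d & Hd & Hx).
    exists (d / 2). split; [lra|]. intros y Hy.
    exists (d / 2). split; [lra|]. intros y' Hy' Ky'. apply Hx; [|exact Ky'].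
    pose proof (Cmod_triangle (y' - y) (y - x)) as H.
    replace (y' - y + (y - x))%C with (y' - x)%C in H by ring. lra.
  - intros x Hx. destruct (Hlt x Hx) as (i & Ki & Hi).
    exists (exist _ i Ki). now apply Hlsc.
  - assert (Hcov : forall x, K x -> exists i, In i l /\ phi (proj1_sig i) < phi x).
    { intros x Hx. destruct (Hl x Hx) as (i & Hi & d & Hd & Hy).
      exists i. split; [exact Hi|]. apply Hy; [|exact Hx].
      replace (x - x)%C with (RtoC 0) by ring. now rewrite Cmod_0. }
    destruct (Hcov w Hw) as (i & Hi & _).
    destruct (list_argmin _ (fun i => phi (proj1_sig i)) l i Hi)
      as (m & Hm & Hmin).
    destruct (Hcov (proj1_sig m) (proj2_sig m)) as (j & Hj & Hlt').
    specialize (Hmin j Hj). simpl in Hmin. lra.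
Qed.

(** * The squeezing function *)

Lemma disc_in_image_radius (Omega K : C -> Prop) (f F : C -> C) (w : C) (r : R) :
  open Omega -> removable_in Omega K -> K w ->
  holomorphic_on (setminus Omega K) f -> injective_on (setminus Omega K) f ->
  holomorphic_on Omega F ->
  (forall x, setminus Omega K x -> F x = f x) ->
  (forall y, disc0 r y -> exists x, setminus Omega K x /\ f x = y) ->
  r <= Cmod (F w).
Proof.
  intros HO [Hrem HKO] Kw Hf Hinj HF HFf Himg.
  apply Rnot_lt_le. intros L.
  destruct (Himg (F w) L) as (x & [Ox Kx] & Hx).
  assert (Hxw : 0 < Cmod (x - w)).
  { apply Cmod_gt_0. intros E. apply Kx. now rewrite (Cminus_eq_0 x w E). }
  destruct (proj1 (open_Cmod Omega) HO x Ox) as (d1 & Hd1 & HO1).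
  destruct (compact_closed K x (proj1 Hrem) Kx) as (d2 & Hd2 & HK2).
  (* Radii at most |x - w| / 2 separate the closed disc about [x] from the open disc about [w] in
     which [y] is chosen below. *)
  set (rho := Rmin (Rmin d1 d2) (Cmod (x - w)) / 2).
  assert (Hrho : 0 < rho /\ rho < d1 /\ rho < d2 /\ rho <= Cmod (x - w) / 2).
  { unfold rho.
    pose proof (Rmin_l (Rmin d1 d2) (Cmod (x - w))).
    pose proof (Rmin_r (Rmin d1 d2) (Cmod (x - w))).
    pose proof (Rmin_l d1 d2). pose proof (Rmin_r d1 d2).
    assert (0 < Rmin (Rmin d1 d2) (Cmod (x - w)))
      by (repeat apply Rmin_pos; assumption). lra. }
  assert (HD : forall y, Cmod (y - x) <= rho -> setminus Omega K y)
    by (intros y Hy; split; [apply HO1 | apply HK2]; lra).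
  destruct (open_mapping f x rho) as (eta & Heta & Hopen).
  - lra.
  - intros y Hy. now apply Hf, HD.
  - intros y Hy E. apply Hinj in E; [|now apply HD; lra|now split].
    subst y. replace (x - x)%C with (RtoC 0) in Hy by ring.
    rewrite Cmod_0 in Hy. lra.
  - destruct (cdiff_ccont F w (HF w (HKO w Kw)) eta Heta) as (d3 & Hd3 & HF3).
    destruct (proj1 (open_Cmod Omega) HO w (HKO w Kw)) as (d4 & Hd4 & HO4).
    set (d := Rmin (Rmin d3 d4) (Cmod (x - w) / 2)).
    assert (Hd : 0 < d /\ d <= d3 /\ d <= d4 /\ d <= Cmod (x - w) / 2).
    { unfold d. pose proof (Rmin_l (Rmin d3 d4) (Cmod (x - w) / 2)).
      pose proof (Rmin_r (Rmin d3 d4) (Cmod (x - w) / 2)).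
      pose proof (Rmin_l d3 d4). pose proof (Rmin_r d3 d4).
      assert (0 < Rmin (Rmin d3 d4) (Cmod (x - w) / 2))
        by (repeat apply Rmin_pos; lra). lra. }
    (* Off [K] one has f(y) = F(y), close to F(w) = f(x), so f(y) is attained in the disc about [x]
       as well; injectivity would put [y] in both discs. *)
    destruct (removable_dense_complement K w d Hrem) as (y & Hyw & Ky); [lra|].
    assert (Dy : setminus Omega K y) by (split; [apply HO4; lra | exact Ky]).
    destruct (Hopen (f y)) as (y' & Hy'x & E).
    { rewrite <- (HFf y Dy), Hx. apply HF3. lra. }
    apply Hinj in E; [|now apply HD|exact Dy]. subst y'.
    pose proof (Cmod_triangle (x - y) (y - w)) as H.
    replace (x - y + (y - w))%C with (x - w)%C in H by ring.
    rewrite (Cmod_minus_sym x y) in H. lra.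
Qed.

(** Continuity carries the bound to points of [K], as the complement of [K] is dense. *)
Lemma extension_bound (Omega K : C -> Prop) (F : C -> C) (M : R) :
  open Omega -> removable_in Omega K -> holomorphic_on Omega F ->
  (forall x, setminus Omega K x -> Cmod (F x) <= M) ->
  forall w, Omega w -> Cmod (F w) <= M.
Proof.
  intros HO [Hrem HKO] HF HM w Ow. apply Rnot_lt_le. intros L.
  destruct (cdiff_ccont F w (HF w Ow) (Cmod (F w) - M)) as (d & Hd & Hy); [lra|].
  destruct (proj1 (open_Cmod Omega) HO w Ow) as (d' & Hd' & HO').
  destruct (classic (K w)) as [Kw|Kw].
  - destruct (removable_dense_complement K w (Rmin d d') Hrem) as (y & Hyw & Ky);
      [now apply Rmin_pos|].
    pose proof (Rmin_l d d'). pose proof (Rmin_r d d').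
    specialize (Hy y ltac:(lra)).
    assert (H1 : Cmod (F y) <= M) by (apply HM; split; [apply HO'; lra | exact Ky]).
    pose proof (Cmod_minus_ge (F w) (F y)) as H2.
    rewrite Cmod_minus_sym in H2. lra.
  - specialize (HM w (conj Ow Kw)). lra.
Qed.

(* The scaled maps t F with t < 1 avoid the strict maximum principle for F. *)
Lemma extension_le_tanh_caratheodory (Omega K : C -> Prop) (F : C -> C) (z w : C) :
  is_domain Omega -> removable_in Omega K -> holomorphic_on Omega F ->
  (forall x, setminus Omega K x -> Cmod (F x) <= 1) ->
  Omega z -> F z = RtoC 0 -> Omega w ->
  Cmod (F w) <= tanh (caratheodory Omega z w).
Proof.
  intros HO HK HF HF1 Oz Fz Ow.
  pose proof (extension_bound Omega K F 1 (proj1 (proj2 HO)) HK HF HF1) as HF1'.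
  assert (Ht : forall t, 0 <= t < 1 ->
             t * Cmod (F w) <= tanh (caratheodory Omega z w)).
  { intros t Ht.
    replace (t * Cmod (F w)) with (Cmod (t * F w)).
    2:{ rewrite Cmod_mult, Cmod_R, Rabs_pos_eq by lra. reflexivity. }
    apply (Cmod_le_tanh_caratheodory Omega z w (fun x => t * F x)%C HO Oz Ow).
    - split.
      + intros x Hx. apply cdiff_mult; [apply cdiff_const | now apply HF].
      + intros x Hx. unfold disc0.
        rewrite Cmod_mult, Cmod_R, Rabs_pos_eq by lra.
        specialize (HF1' x Hx). pose proof (Cmod_ge_0 (F x)). nra.
    - rewrite Fz. ring. }
  apply Rnot_lt_le. intros L.
  set (T := tanh (caratheodory Omega z w)) in *.
  assert (H0 : 0 <= T) by (specialize (Ht 0 ltac:(lra)); lra).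
  (* If T < |F w|, this factor is below 1 and scales |F w| to the midpoint of [T] and |F w|, which
     exceeds [T]. *)
  assert (H1 : (T + Cmod (F w)) / (2 * Cmod (F w)) * Cmod (F w) <= T).
  { apply Ht. split; [apply Rdiv_le_0_compat; lra|].
    apply Rlt_div_l; lra. }
  replace (_ / _ * _) with ((T + Cmod (F w)) / 2) in H1 by (field; lra).
  lra.
Qed.

Theorem theorem1p9 :
  forall Omega K : C -> Prop,
    is_domain Omega -> bounded_set Omega ->
    (exists w, K w) -> removable_in Omega K ->
    forall z : C, setminus Omega K z ->
      exists w0 : C,
        K w0 /\
        (forall w, K w ->
           tanh (caratheodory Omega z w0) <= tanh (caratheodory Omega z w)) /\
        squeezing (setminus Omega K) z <= tanh (caratheodory Omega z w0).
Proof.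
  intros Omega K HO _ HKne HK z Hz.
  destruct (lsc_attains_min K (caratheodory Omega z)) as (w0 & Kw0 & Hmin).
  - apply HK.
  - exact HKne.
  - intros w a Kw Ha.
    destruct (caratheodory_lsc Omega z w a HO (proj1 Hz) (proj2 HK w Kw) Ha)
      as (d & Hd & Hy).
    exists d. split; [exact Hd|]. intros y Hyd Ky. apply Hy; [exact Hyd|].
    now apply HK.
  - exists w0. split; [exact Kw0|]. split.
    { intros w Kw. now apply tanh_le, Hmin. }
    assert (Ow0 : Omega w0) by now apply HK.
    (* Nonnegativity is the side condition of [Rsup_le] for both nested suprema. *)
    assert (H0 : 0 <= tanh (caratheodory Omega z w0)).
    { rewrite <- Cmod_0.
      apply (Cmod_le_tanh_caratheodory Omega z w0 (fun _ => RtoC 0));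
        [exact HO | apply Hz | exact Ow0 | apply hol_to_disc_0 | reflexivity]. }
    apply Rsup_le; [exact H0|]. intros s (f & Hf & Hinj & Hfz & ->).
    apply Rsup_le; [exact H0|]. intros r Hr.
    destruct (proj2 (proj1 HK) Omega (proj1 (proj2 HO)) (proj2 HK) f (proj1 Hf))
      as (F & HF & HFf).
    { exists 1. intros x Hx. left. now apply Hf. }
    apply Rle_trans with (Cmod (F w0)).
    + apply (disc_in_image_radius Omega K f F w0 r); auto; [apply HO | apply Hf].
    + apply (extension_le_tanh_caratheodory Omega K F z w0); auto.
      * intros x Hx. rewrite HFf by exact Hx. left. now apply Hf.
      * apply Hz.
      * now rewrite HFf.
Qed.
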